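(* Let $I=\langle x^{a_i}y^{b_i}\mid 0\le i\le r\rangle$ be a monomial ideal of $R$ with $r\ge 2$, $a_0>a_1>\dots>a_{r-1}>a_r=0$, $b_0=0<b_1<\dots<b_{r-1}<b_r$ and $a_0\le b_r$, and assume that $I$ is complete. If either (1) $r\ge 3$, or (2) $r=2$ and $xy\notin I$ is satisfied, then the associated module $M=M(I;2)$ is an indecomposable integrally closed $R$-module of rank $2$ with $I(M)=I$.
   Context: $(R,\mathfrak m)$ is a two-dimensional regular local ring with infinite residue field, and $x,y$ is a fixed regular system of parameters, $\mathfrak m=\langle x,y\rangle$. An ideal is complete if it is integrally closed. The module $M(I;e)$: for $I$ as in the claim and $2\le e\le r$ (here $e=2$), put $a_i'=a_i-e+1$ for $0\le i\le r-e+1$ and $c_i=b_{r-e+1+i}-i$ for $1\le i\le e-1$. Let $\epsilon_1,\dots,\epsilon_e$ be the standard basis of $R^e$. Then $M(I;e)\subset F:=R^e$ is the submodule generated by $f_i=x^{a_i'}y^{b_i}\epsilon_1$ for $0\le i\le r-e+1$, $g_i=y\,\epsilon_i+x\,\epsilon_{i+1}$ for $1\le i\le e-1$, $h_i=y^{c_i}\epsilon_{i+1}$ for $1\le i\le e-1$. For a finitely generated torsion-free $R$-module $M$, the double dual $M^{**}$ is free and contains $M$ with finite-length quotient; $I(M)=\operatorname{Fitt}_0(M^{**}/M)$. (For $M=M(I;e)$ one has $M^{**}=R^e$, so $I(M)$ is the ideal generated by the maximal minors of the matrix whose columns are $f_0,\dots,f_{r-e+1},g_1,\dots,g_{e-1},h_1,\dots,h_{e-1}$.)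 Integral closure of modules (Rees): with $K$ the fraction field of $R$, $M_K=M\otimes_R K$, and $MV$ the image of $M\otimes_R V\to M_K$ for $R\subset V\subset K$, set $\overline M=\{f\in M_K\mid f\in MV$ for every discrete valuation ring $V$ with $R\subset V\subset K\}$; $M$ is integrally closed if $\overline M=M$. *)

(* Defs.v *)
From HB Require Import structures.
From mathcomp Require Import all_boot all_order all_algebra.
From mathcomp Require Import boolp classical_sets functions cardinality.

Set Implicit Arguments.
Unset Strict Implicit.
Unset Printing Implicit Defensive.

Import Order.TTheory GRing.Theory Num.Theory.
Local Open Scope classical_set_scope.
Local Open Scope ring_scope.

(* [lspan S X]: finite sums of elements of [X] with coefficients in [S].  For a
   subring [S] of [R] this is the [S]-submodule of [W] generated by [X]; [S] is
   the whole ring, or a subring of a field acting on a vector space. *)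
Definition lspan (R : nzRingType) (W : lmodType R) (S : set R) (X : set W) :
    set W :=
  [set w | exists n (c : 'I_n -> R) (u : 'I_n -> W),
      [/\ forall i, S (c i), forall i, X (u i) & w = \sum_i c i *: u i]].

Definition submodule (R : nzRingType) (W : lmodType R) (N : set W) : Prop :=
  submod_closed [in N].

Section Ideals.
Variable R : comNzRingType.

Definition ideal_gen (X : set R) : set R := lspan [set: R] (X : set R^o).

Definition prime_ideal (P : set R) : Prop :=
  idealr_closed [in P] /\ prime_idealr_closed [in P].

(* [idealr_closed] includes properness: 1 is not in the ideal. *)
Definition maximal_ideal (m : set R) : Prop :=
  idealr_closed [in m] /\
  (forall J : set R, idealr_closed [in J] -> m `<=` J -> J = m).

Definition noetherian : Prop :=
  forall J : set R, submodule (J : set R^o) ->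
    exists s : seq R, J = ideal_gen [set` s].

Definition local_ring (m : set R) : Prop :=
  maximal_ideal m /\ (forall m' : set R, maximal_ideal m' -> m' = m).

(* P_0 < P_1 < ... < P_n *)
Definition prime_chain (n : nat) (P : nat -> set R) : Prop :=
  (forall i, (i <= n)%N -> prime_ideal (P i)) /\
  (forall i, (i < n)%N -> P i `<` P i.+1).

Definition krull_dim (d : nat) : Prop :=
  (exists P, prime_chain d P) /\
  (forall n P, prime_chain n P -> (n <= d)%N).

Definition regular_local_ring (m : set R) (d : nat) : Prop :=
  [/\ noetherian, local_ring m, krull_dim d
    & exists s : d.-tuple R, m = ideal_gen [set` s]].

(* The elements of R / J, as the cosets a + J. *)
Definition cosets (J : set R) : set (set R) :=
  [set [set a + u | u in J] | a in [set: R]].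

Definition ideal_pow (J : set R) (n : nat) : set R :=
  ideal_gen
    [set \prod_(i < n) u i | u in [set u : 'I_n -> R | forall i, J (u i)]].

(* z^n + c_1 z^(n-1) + ... + c_n = 0 with c_i in J^i *)
Definition integral_over_ideal (J : set R) (z : R) : Prop :=
  exists n (c : nat -> R),
    [/\ (0 < n)%N,
        forall i, (1 <= i <= n)%N -> ideal_pow J i (c i)
      & z ^+ n + \sum_(1 <= i < n.+1) c i * z ^+ (n - i) = 0].

Definition complete_ideal (J : set R) : Prop :=
  forall z, integral_over_ideal J z -> J z.

End Ideals.

Section Fitting.
Variable R : comNzRingType.

(* Hom_R(M, R), a linear form on [M] being extended by 0 to the ambient module
   so as to be determined by its values on [M]. *)
Definition dual (W : lmodType R) (M : set W) : set (W -> R^o) :=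
  [set phi | (forall a u v, M u -> M v ->
                phi (a *: u + v) = a *: phi u + phi v) /\
             (forall w, ~ M w -> phi w = 0)].

Definition bidual (W : lmodType R) (M : set W) : set ((W -> R^o) -> R^o) :=
  dual (dual M).

(* The canonical map M -> M**. *)
Definition bidual_ev (W : lmodType R) (M : set W) (w : W) :
    (W -> R^o) -> R^o :=
  patch (fun=> 0) (dual M) (fun phi => phi w).

(* [J] = Fitt_0(N / M): [u] is a finite system of generators of [N] modulo [M]
   and the columns of [A] run over the relations between them; the square
   matrices of relations yield the maximal minors of every presentation matrix.
   The ideal does not depend on [u]. *)
Definition is_fitting0 (W : lmodType R) (N M : set W) (J : set R) : Prop :=
  exists n (u : 'I_n -> W),
    N = lspan [set: R] (range u `|` M) /\
    J = ideal_gen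
          [set \det A | A in [set A : 'M[R]_n |
                               forall j, M (\sum_i A i j *: u i)]].

(* J = I(M) = Fitt_0(M** / M) *)
Definition is_ideal_of_module (W : lmodType R) (M : set W) (J : set R) : Prop :=
  is_fitting0 (bidual M) (bidual_ev M @` M) J.

End Fitting.

Definition indecomposable (R : nzRingType) (W : lmodType R) (M : set W) : Prop :=
  M <> [set 0] /\
  forall N1 N2 : set W, submodule N1 -> submodule N2 ->
    M = [set u + v | u in N1 & v in N2] -> N1 `&` N2 = [set 0] ->
    N1 = [set 0] \/ N2 = [set 0].

(* v(0) = +oo is left out: the value of [v] at 0 is irrelevant. *)
Definition discrete_valuation (K : fieldType) (v : K -> int) : Prop :=
  [/\ forall a b, a != 0 -> b != 0 -> v (a * b) = v a + v b,
      forall a b, a != 0 -> b != 0 -> a + b != 0 ->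
        Num.min (v a) (v b) <= v (a + b)
    & forall k : int, exists2 a, a != 0 & v a = k].

(* Discrete valuation rings of [K], i.e. with field of fractions [K]. *)
Definition dvr_of (K : fieldType) (V : set K) : Prop :=
  exists2 v : K -> int, discrete_valuation v
    & V = [set a | a = 0 \/ 0 <= v a].

Section FractionField.
Variable R : idomainType.
Local Notation K := {fraction R}.

(* For a submodule M of R^n, the modules M_K and MV are realized inside K^n: M_K
   is the K-span of the image of M, and MV its V-span. *)
Definition frac_image n (M : set 'cV[R]_n) : set 'cV[K]_n :=
  [set map_mx (@tofrac R) w | w in M].

Definition frac_module n (M : set 'cV[R]_n) : set 'cV[K]_n :=
  lspan [set: K] (frac_image M).

Definition has_rank n (M : set 'cV[R]_n) (d : nat) : Prop :=
  exists2 U : {vspace 'cV[K]_n}, frac_module M = [set` U] & \dim U = d.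

(* A discrete valuation ring V with R <= V <= K has field of fractions K. *)
Definition module_closure n (M : set 'cV[R]_n) : set 'cV[K]_n :=
  [set f | frac_module M f /\
     forall V : set K, dvr_of V -> range (@tofrac R) `<=` V ->
       lspan V (frac_image M) f].

Definition integrally_closed_module n (M : set 'cV[R]_n) : Prop :=
  module_closure M = frac_image M.

End FractionField.

Section ModuleOfMonomialIdeal.
Variables (R : comNzRingType) (x y : R) (r : nat) (a b : nat -> nat).

Definition monomial_ideal : set R :=
  ideal_gen [set x ^+ a i * y ^+ b i | i in [set i | (i <= r)%N]].

(* The standard basis vectors are eps e 1, ..., eps e e. *)
Definition eps (e k : nat) : 'cV[R]_e := \col_(j < e) (j.+1 == k)%:R.

(* M(I; e).  The natural number subtractions are never truncated: under the
   hypotheses on the exponents, a_i >= r - i and b_j >= j. *)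
Definition module_of (e : nat) : set 'cV[R]_e :=
  let a' i := (a i + 1 - e)%N in
  let c i := (b (r - e + 1 + i) - i)%N in
  lspan [set: R]
    ([set (x ^+ a' i * y ^+ b i) *: eps e 1 | i in [set i | (i <= r - e + 1)%N]]
     `|` [set y *: eps e i + x *: eps e i.+1 | i in [set i | (1 <= i <= e - 1)%N]]
     `|` [set y ^+ c i *: eps e i.+1 | i in [set i | (1 <= i <= e - 1)%N]]).

End ModuleOfMonomialIdeal.

Arguments module_of {R} x y r a b e.

(* Main.v *)
Require Import Defs.
From HB Require Import structures.
From mathcomp Require Import all_boot all_order all_algebra.
From mathcomp Require Import boolp classical_sets functions cardinality.
From mathcomp Require Import generic_quotient zify ring.

(** Write [c = b r - 1], and let [f_i], [g = (y, x)], [h = (0, y^c)] be the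
    generators of [M = M(I; 2)].

    Fitting ideal. The [2 x 2] minors of the generators lie in [I], and
    [f_i /\ g] and [g /\ h] are the generators of [I]. As [M] contains large
    powers of [x] and of [y] times each basis vector, and [x, y] is a regular
    sequence, a linear form on [M] is a linear form on the plane ([dual_coords]);
    so the bidual of [M] is [R^2] and [I(M) = I].

    Integral closure. Let [(u, v)] be in [M V] for every discrete valuation ring
    [V]. First, [u] and [v] are in [R], because [R] is the intersection of these
    rings ([valuatively_integral]): every prime of [R] except the maximal ideal is
    principal, and a fraction outside [R] has one of these primes in its
    denominator. Next, [v] is in [(x, y^c) V] and [u x - v y], a minor of [M V],
    is in [I V] for every [V]. Monomial ideals such as [(x, y^c)] and the complete
    ideal [I] are determined by the monomial valuations, so [v] is in [(x, y^c)]
    and [u x - v y] is in [I]. Subtracting a combination of [g] and [h] makes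
    [v = 0], and then [u] is in [I : x], which is exactly the ideal of the [u]
    such that [(u, 0)] is in [M].

    The monomial valuations are built from the filtration of [R] by weighted
    order ([weight_filtration]): leading terms multiply, because a monomial that
    belongs to an ideal generated by monomials is a multiple of one of them
    ([monomial_in_span]). They determine [I] since a monomial outside the complete
    ideal [I] lies below the Newton polygon of [I] and is separated from it by a
    line with positive integral coefficients ([complete_separated]).

    Indecomposability. Two nonzero summands of [M] have rank one, so each lies on
    a line. Modulo [m^2] the module [M] is contained in the span of [(x, 0)] and
    [(y, x)] ([module_initial_form], where the hypothesis on [r] and [x y] is
    used), so one of the two components of [g] has entries [p, q] that again form
    a regular system of parameters. The other summand then contains, up to powers
    of [x], a vector whose determinant with [(p, q)] would be [1], which is absurd
    as [p] and [q] are in the maximal ideal ([no_rank1_splitting]). *)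

Set Implicit Arguments.
Unset Strict Implicit.
Unset Printing Implicit Defensive.

Import Order.TTheory GRing.Theory Num.Theory.
Local Open Scope classical_set_scope.
Local Open Scope ring_scope.
Local Open Scope quotient_scope.

(** * Spans, ideals and chain conditions *)

Section Span.
Variables (R : nzRingType) (W : lmodType R).
Implicit Types (S : set R) (X N : set W).

Lemma submoduleP N :
  submodule N <-> N 0 /\ forall a u v, N u -> N v -> N (a *: u + v).
Proof.
split=> -[N0 NL]; split; first exact/set_mem.
- by move=> a u v Nu Nv; apply/set_mem/NL; exact/mem_set.
- exact/mem_set.
- by move=> a u v /set_mem Nu /set_mem Nv; apply/mem_set/NL.
Qed.

Lemma submodule0 N : submodule N -> N 0.
Proof. by case/submoduleP. Qed.

Lemma submoduleD N u v : submodule N -> N u -> N v -> N (u + v).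
Proof. by case/submoduleP=> _ NL Nu Nv; rewrite -[u]scale1r; exact: NL. Qed.

Lemma submoduleZ N a u : submodule N -> N u -> N (a *: u).
Proof. by case/submoduleP=> N0 NL Nu; rewrite -[_ *: _]addr0; exact: NL. Qed.

Lemma submodule_sum N n (F : 'I_n -> W) :
  submodule N -> (forall i, N (F i)) -> N (\sum_i F i).
Proof.
move=> sN NF; elim/big_ind: _ => //; first exact: submodule0.
by move=> u v; exact: submoduleD.
Qed.

Lemma lspan_gen S X u : S 1 -> X u -> lspan S X u.
Proof.
move=> S1 Xu; exists 1%N, (fun=> 1), (fun=> u).
by split=> //; rewrite big_ord1 scale1r.
Qed.

Lemma lspan_submodule X : submodule (lspan [set: R] X).
Proof.
apply/submoduleP; split.
  by exists 0%N, (fun=> 0), (fun=> 0); split=> [|[]|] //; rewrite big_ord0.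
move=> a _ _ [n [c [u [_ Xu ->]]]] [n' [c' [u' [_ Xu' ->]]]].
pose C k := match fintype.split k with inl i => a * c i | inr i => c' i end.
pose U k := match fintype.split k with inl i => u i | inr i => u' i end.
exists (n + n')%N, C, U; split=> //.
  by move=> k; rewrite /U; case: fintype.split.
rewrite big_split_ord /= scaler_sumr; congr (_ + _); apply: eq_bigr => i _.
  by rewrite /C /U (unsplitK (inl i)) scalerA.
by rewrite /C /U (unsplitK (inr i)).
Qed.

Lemma lspan_min S X N : submodule N -> X `<=` N -> lspan S X `<=` N.
Proof.
move=> sN XN _ [n [c [u [_ Xu ->]]]].
by apply: submodule_sum => // i; apply: submoduleZ => //; exact: XN.
Qed.

End Span.

Section IdealBasics.
Variable R : comNzRingType.
Implicit Types (J X : set R) (a b t u v z : R).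

Definition ideal J := submodule (J : set R^o).

Lemma idealP J : ideal J <-> J 0 /\ forall a u v, J u -> J v -> J (a * u + v).
Proof. exact: submoduleP. Qed.

Lemma ideal0 J : ideal J -> J 0.
Proof. exact: submodule0. Qed.

Lemma idealD J u v : ideal J -> J u -> J v -> J (u + v).
Proof. exact: submoduleD. Qed.

Lemma idealMl J a u : ideal J -> J u -> J (a * u).
Proof. exact: submoduleZ. Qed.

Lemma idealMr J a u : ideal J -> J u -> J (u * a).
Proof. by move=> iJ Ju; rewrite mulrC; exact: idealMl. Qed.

Lemma idealN J u : ideal J -> J u -> J (- u).
Proof. by move=> iJ Ju; rewrite -mulN1r; exact: idealMl. Qed.

Lemma idealB J u v : ideal J -> J u -> J v -> J (u - v).
Proof. by move=> iJ Ju Jv; apply: idealD => //; exact: idealN. Qed.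

Lemma ideal_gen_ideal X : ideal (ideal_gen X).
Proof. exact: lspan_submodule. Qed.

Lemma ideal_gen_in X u : X u -> ideal_gen X u.
Proof. exact: (@lspan_gen R R^o). Qed.

Lemma ideal_gen_min X J : ideal J -> X `<=` J -> ideal_gen X `<=` J.
Proof. exact: (@lspan_min R R^o). Qed.

Lemma ideal_gen2 s t z :
  ideal_gen [set s; t] z <-> exists c d, z = s * c + t * d.
Proof.
split=> [|[c [d ->]]]; last first.
  by apply: idealD; [exact: ideal_gen_ideal | |];
    apply: idealMr; (exact: ideal_gen_ideal || apply: ideal_gen_in; by [left|right]).
move: z; apply: ideal_gen_min => [|z [->|->]].
- apply/idealP; split; first by exists 0, 0; rewrite !mulr0 addr0.
  move=> a _ _ [c [d ->]] [c' [d' ->]].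
  by exists (a * c + c'), (a * d + d'); ring.
- by exists 1, 0; rewrite mulr1 mulr0 addr0.
- by exists 0, 1; rewrite mulr1 mulr0 add0r.
Qed.

Lemma idealr_closedP J :
  idealr_closed [in J] <-> ideal J /\ ~ J 1.
Proof.
split=> [[J0 J1 JL]|[/idealP[J0 JL] J1]]; split.
- apply/idealP; split; first exact/set_mem.
  by move=> a u v Ju Jv; apply/set_mem/JL; exact/mem_set.
- by move=> /mem_set; apply/negP.
- exact/mem_set.
- by apply/negP => /set_mem.
- by move=> a u v /set_mem Ju /set_mem Jv; apply/mem_set/JL.
Qed.

Lemma prime_idealP J :
  prime_ideal J <->
  [/\ ideal J, ~ J 1 & forall u v, J (u * v) -> J u \/ J v].
Proof.
split=> [[/idealr_closedP[iJ J1] Jp]|[iJ J1 Jp]].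
  split=> // u v /mem_set /Jp /orP[] /set_mem; by [left|right].
split; first exact/idealr_closedP.
by move=> u v /set_mem /Jp[] /mem_set ->; rewrite ?orbT.
Qed.

End IdealBasics.

Section Noetherian.
Variables (R : comNzRingType) (noethR : noetherian R).
Implicit Types (J : set R) (F : set (set R)) (a t u v z : R).

(** The union of an ascending chain is finitely generated, hence it is already
    reached by one of its members. *)
Lemma ascending_chain_stable (D : nat -> set R) :
  (forall n, ideal (D n)) -> (forall n, D n `<=` D n.+1) ->
  exists n, forall k, D k `<=` D n.
Proof.
move=> iD Dinc.
have Dmono n k : (n <= k)%N -> D n `<=` D k.
  move=> /subnK <-; elim: (k - n)%N => // d IH u /IH; exact: Dinc.
pose U : set R := [set z | exists n, D n z].
have iU : ideal U.
  apply/idealP; split; first by exists 0%N; exact: ideal0.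
  move=> a u v [n Du] [k Dv]; exists (maxn n k); apply: idealD => //.
    by apply: idealMl => //; apply: Dmono Du; rewrite leq_maxl.
  by apply: Dmono Dv; rewrite leq_maxr.
have [s defU] := noethR iU.
have [n Dn] : exists n, [set` s] `<=` D n.
  have : [set` s] `<=` U by rewrite defU => u; exact: ideal_gen_in.
  elim: s {defU} => [|u s IH] sU; first by exists 0%N => u.
  have [|n Dn] := IH.
    by move=> v sv; apply: sU; rewrite /= inE sv orbT.
  have [k Du] : U u by apply: sU; rewrite /= inE eqxx.
  exists (maxn n k) => v; rewrite /= inE => /orP[/eqP->|sv].
    by apply: Dmono Du; rewrite leq_maxr.
  by apply: (Dmono n); rewrite ?leq_maxl //; exact: Dn.
exists n => k u Du; apply: (ideal_gen_min (iD n) Dn).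
by rewrite -defU; exists k.
Qed.

Lemma ideal_family_max F J0 :
  F J0 -> (forall J, F J -> ideal J) ->
  exists2 J, F J & forall J', F J' -> J `<=` J' -> J' `<=` J.
Proof.
move=> F0 Fi; apply: contrapT => noMax.
have next J : exists J', F J -> [/\ F J', J `<=` J' & ~ J' `<=` J].
  have [FJ|] := pselect (F J); last by exists J.
  apply: contrapT => noJ'; apply: noMax; exists J => // J' FJ' JJ'.
  by apply: contrapT => J'J; apply: noJ'; exists J'.
have [nx nxP] := choice next.
pose D n := iter n nx J0.
have FD n : F (D n) by elim: n => //= n /nxP[].
have [||n Dn] := ascending_chain_stable (D := D).
- by move=> n; exact: Fi.
- by move=> n; have [] := nxP _ (FD n).
- by have [_ _ []] := nxP _ (FD n); exact: (Dn n.+1).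
Qed.

(** The ideals [D n] of those [z] with [t^(n+1) z] in [J + (t a)] form an
    ascending chain. If [D (n+1) = D n] and [a = u + t^(n+1) z], then [z] is in
    [D (n+1)], hence in [D n], and [a] is in [J + (t a)]. *)
Lemma krull_intersection J t a :
  ideal J ->
  (forall n, exists2 u, J u & exists z, a = u + t ^+ n * z) ->
  exists c, J ((1 - t * c) * a).
Proof.
move=> iJ aJ.
pose D n : set R := [set z | exists c, J (t ^+ n.+1 * z - c * (t * a))].
have [||n Dn] := ascending_chain_stable (D := D).
- move=> n; apply/idealP; split.
    by exists 0; rewrite mulr0 mul0r subr0; exact: ideal0.
  move=> b u v [c Ju] [d Jv]; exists (b * c + d).
  have -> : t ^+ n.+1 * (b * u + v) - (b * c + d) * (t * a) =
    b * (t ^+ n.+1 * u - c * (t * a)) + (t ^+ n.+1 * v - d * (t * a)) by ring.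
  by apply: idealD => //; exact: idealMl.
- move=> n z [c Jz]; exists (t * c).
  rewrite exprS; have -> : t * t ^+ n.+1 * z - t * c * (t * a) =
    t * (t ^+ n.+1 * z - c * (t * a)) by ring.
  exact: idealMl.
have [u Ju [z az]] := aJ n.+1.
have [|c Jz] := Dn n.+1 z.
  exists 1; rewrite [X in t * X]az exprS.
  have -> : t * t ^+ n.+1 * z - 1 * (t * (u + t ^+ n.+1 * z)) = - t * u by ring.
  exact: idealMl.
exists c.
have -> : (1 - t * c) * a = u + (t ^+ n.+1 * z - c * (t * a)).
  by rewrite addrA -az; ring.
exact: idealD.
Qed.

End Noetherian.

(** * Two-dimensional regular local rings *)

Definition divides (R : comNzRingType) (s z : R) : Prop := exists c, z = s * c.

Definition prime_elem (R : comNzRingType) (f : R) : Prop :=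
  [/\ f != 0, ~ divides f 1
    & forall u v, divides f (u * v) -> divides f u \/ divides f v].

Lemma divides_ideal (R : comNzRingType) (s : R) : ideal (divides s).
Proof.
apply/idealP; split; first by exists 0; rewrite mulr0.
by move=> a _ _ [c ->] [d ->]; exists (a * c + d); ring.
Qed.

Section LocalRing.
Variables (R : idomainType) (m : set R).
Hypotheses (noethR : noetherian R) (locR : local_ring m).
Implicit Types (J Q : set R) (a b c f t u v x y z : R).

Lemma max_ideal : ideal m.
Proof. by have [[/idealr_closedP[]]] := locR. Qed.

Lemma max_proper : ~ m 1.
Proof. by have [[/idealr_closedP[]]] := locR. Qed.

Lemma proper_sub_max J : ideal J -> ~ J 1 -> J `<=` m.
Proof.
move=> iJ J1.
pose F := [set J' : set R | [/\ ideal J', ~ J' 1 & J `<=` J']].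
have [||J' [iJ' J'1 JJ'] maxJ'] := ideal_family_max (F := F) noethR (J0 := J).
- by split.
- by move=> J' [].
suff <- : J' = m by [].
have [_ uniq_m] := locR; apply: uniq_m; split; first exact/idealr_closedP.
move=> L /idealr_closedP[iL L1] J'L; apply/seteqP; split=> //.
by apply: maxJ' => //; split=> // u /JJ' /J'L.
Qed.

Lemma max_nonunit z : m z -> z \isn't a GRing.unit.
Proof.
move=> mz; apply/negP => Uz; apply: max_proper.
by rewrite -(mulVr Uz); apply: idealMl => //; exact: max_ideal.
Qed.

Lemma nonunit_max z : ~ m z -> z \is a GRing.unit.
Proof.
move=> mz; apply: contrapT => Uz; apply: mz.
apply: (proper_sub_max (divides_ideal z)); last by exists 1; rewrite mulr1.
case=> c zc; apply: Uz; apply/unitrP; exists c.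
by rewrite mulrC -zc.
Qed.

Lemma unit_addmax u z : u \is a GRing.unit -> m z -> u + z \is a GRing.unit.
Proof.
move=> Uu mz; apply: nonunit_max => muz; have := max_nonunit (z := u).
rewrite Uu; suff: m u by move=> mu /(_ mu).
by rewrite -(addrK z u); apply: idealB => //; exact: max_ideal.
Qed.

Lemma krull_local J t a :
  ideal J -> m t ->
  (forall n, exists2 u, J u & exists z, a = u + t ^+ n * z) -> J a.
Proof.
move=> iJ mt /(krull_intersection noethR iJ)[c Ja].
have U1 : 1 - t * c \is a GRing.unit.
  rewrite -mulrN; apply: unit_addmax (unitr1 _) _.
  by apply: idealMr => //; exact: max_ideal.
by rewrite -(mulKr U1 a); exact: idealMl.
Qed.

Section SystemOfParameters.
Variables (x y : R).
Hypothesis (mE : m = ideal_gen [set x; y]).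

Lemma maxP z : m z <-> exists c d, z = x * c + y * d.
Proof. by rewrite mE; exact: ideal_gen2. Qed.

Lemma param_max1 : m x.
Proof. by rewrite mE; apply: ideal_gen_in; left. Qed.

Lemma param_max2 : m y.
Proof. by rewrite mE; apply: ideal_gen_in; right. Qed.

(** Modulo [x] the maximal ideal is generated by [y], so [R/(x)] is a discrete
    valuation ring or an Artinian quotient of one. *)
Lemma mod_param a :
  ~ divides x a -> exists n u c, u \is a GRing.unit /\ a = y ^+ n * u + x * c.
Proof.
move=> xNa.
pose P n := `[< exists c z, a = x * c + y ^+ n * z >].
have exN : exists n, ~~ P n.
  apply: contrapT => noN; apply: xNa.
  apply: (krull_local (divides_ideal x) param_max2) => n.
  have /asboolP[c [z ->]] : P n.
    by apply: contrapT => nP; apply: noN; exists n; exact/negP.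
  by exists (x * c); [exists c|exists z].
have [[|n] nPn minn] := ex_minnP exN.
  by case/negP: nPn; apply/asboolP; exists 0, a; rewrite mulr0 add0r mul1r.
have /asboolP[c [z az]] : P n.
  by apply: contrapT => /negP /minn; rewrite ltnn.
exists n, z, c; split; last by rewrite az addrC.
apply: nonunit_max => /maxP[d [e ze]]; case/negP: nPn; apply/asboolP.
by exists (c + y ^+ n * d), e; rewrite az ze exprS; ring.
Qed.

(** With [f] in [Q] of least [y]-order modulo [x], every element of [Q] lies in
    [(f) + (x)], hence in [(f) + xQ] because [x] is not in [Q]; then Krull's
    theorem modulo [(f)] gives [Q = (f)]. *)
Lemma prime_principal Q :
  prime_ideal Q -> ~ Q x -> exists f, Q = divides f.
Proof.
move=> /prime_idealP[iQ Q1 Qp] Qx.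
have peel f : Q f -> (forall g, Q g -> exists c d, g = f * c + x * d) ->
  Q = divides f.
  move=> Qf QE; apply/seteqP; split=> [g Qg|_ [c ->]]; last exact: idealMr.
  apply: (krull_local (divides_ideal f) param_max1) => n.
  suff [c [d [Qd ->]]] : exists c d, Q d /\ g = f * c + x ^+ n * d.
    by exists (f * c); [exists c|exists d].
  elim: n => [|n [c [d [/[dup] Qd /QE[c' [d' dE]] ->]]]].
    by exists 0, g; split=> //; rewrite mulr0 add0r mul1r.
  exists (c + x ^+ n * c'), d'; split; last by rewrite dE exprS; ring.
  have : Q (x * d').
    by rewrite -(addKr (f * c') (x * d')) -dE addrC; apply: idealB => //; exact: idealMr.
  by case/Qp.
have [Qsub|Qnsub] := pselect (forall g, Q g -> divides x g).
  exists 0; apply: peel; first exact: ideal0.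
  by move=> g /Qsub[d ->]; exists 0, d; rewrite mul0r add0r.
pose P n := `[< exists f, Q f /\ exists u c,
  u \is a GRing.unit /\ f = y ^+ n * u + x * c >].
have exP : exists n, P n.
  move/existsNP: Qnsub => [g /not_implyP[Qg /mod_param[n [u [c guc]]]]].
  by exists n; apply/asboolP; exists g; split=> //; exists u, c.
have [n /asboolP[f [Qf [u [c [Uu fE]]]]] minn] := ex_minnP exP.
exists f; apply: peel => // g Qg.
have [[d ->]|/mod_param[k [v [d [Uv gE]]]]] := pselect (divides x g).
  by exists 0, d; rewrite mulr0 add0r.
have /subnK kE : (n <= k)%N.
  by apply: minn; apply/asboolP; exists g; split=> //; exists v, d.
exists (u^-1 * y ^+ (k - n) * v), (d - c * u^-1 * y ^+ (k - n) * v).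
rewrite gE fE -{1}kE exprD.
have -> : (y ^+ n * u + x * c) * (u^-1 * y ^+ (k - n) * v) =
  (u * u^-1) * y ^+ n * (y ^+ (k - n) * v) + x * c * (u^-1 * y ^+ (k - n) * v)
  by ring.
by rewrite divrr //; ring.
Qed.

Hypothesis dimR : krull_dim R 2.

Lemma intermediate_prime :
  exists Q, [/\ prime_ideal Q, exists2 q, Q q & q != 0 & ~ m `<=` Q].
Proof.
have [[P [Pprime Pstrict]] _] := dimR.
have /prime_idealP[i0 _ _] := Pprime 0%N isT.
have /prime_idealP[i2 P21 _] := Pprime 2%N isT.
have [_ /existsNP[q /not_implyP[Pq P0q]]] := Pstrict 0%N isT.
have [_ P2P1] := Pstrict 1%N isT.
exists (P 1%N); split; first exact: Pprime.
  by exists q => //; apply/eqP => q0; apply: P0q; rewrite q0; exact: ideal0.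
by move=> mP1; apply: P2P1 => z /(proper_sub_max i2 P21) /mP1.
Qed.

(** A case of the principal ideal theorem. If [y^n] were in
    [(x)], an intermediate prime [Q] would avoid [x], hence be principal, [Q =
    (f)]; a power of [f] lies in [(x)], and cancelling [f] repeatedly, which is
    possible because [x] is not in [Q], makes [x] a unit. *)
Lemma param_pow_ndiv n : ~ divides x (y ^+ n).
Proof.
move=> [t ynE].
have [Q [Qprime [q Qq q0] mQ]] := intermediate_prime.
have /prime_idealP[iQ Q1 Qp] := Qprime.
have Qx : ~ Q x.
  move=> Qx; apply: mQ => _ /maxP[c [d ->]].
  apply: idealD => //; apply: idealMr => //.
  have : Q (y ^+ n) by rewrite ynE; exact: idealMr.
  elim: n {ynE} => [|k IH]; first by rewrite expr0.
  by rewrite exprS => /Qp[].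
have [f QE] := prime_principal Qprime Qx.
have f0 : f != 0.
  by apply: contra_neq q0 => f0; move: Qq; rewrite QE f0 => -[c ->]; rewrite mul0r.
have Qf : Q f by rewrite QE; exists 1; rewrite mulr1.
have /maxP[c [d fE]] : m f by apply: proper_sub_max Qf.
have fpow k : exists e, f ^+ k = x * e + y ^+ k * d ^+ k.
  elim: k => [|k [e IH]]; first by exists 0; rewrite !expr0; ring.
  by exists (f * e + c * y ^+ k * d ^+ k); rewrite exprS IH mulrDr {2}fE !exprS; ring.
have : divides x (f ^+ n).
  by have [e ->] := fpow n; rewrite ynE; exists (e + t * d ^+ n); ring.
elim: n {ynE fpow} => [|k IH].
  case=> e xe; have := max_nonunit param_max1; case/negP; apply/unitrP.
  by exists e; rewrite mulrC -xe.
case=> e; rewrite exprS => feE; apply: IH.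
have : Q (x * e) by rewrite -feE; exact: idealMr.
case/Qp => //; rewrite QE => -[e' eE]; exists e'.
by apply: (mulfI f0); rewrite feE eE; ring.
Qed.

End SystemOfParameters.
End LocalRing.

(** What the rest of the argument uses of the regular system of parameters: [R]
    is local with maximal ideal [(x, y)], multiplication by [y] is injective
    modulo [x], and [R] is separated for the topology of the ideals
    [(x^n, y^n)]. *)
Record parameters (R : idomainType) (x y : R) : Prop := RegularPair {
  param_local c : c \is a GRing.unit \/ exists d e, c = x * d + y * e;
  param_proper d e : x * d + y * e <> 1;
  param_neq0l : x != 0;
  param_neq0r : y != 0;
  param_syz a b : x * a = y * b -> divides x b;
  param_sep z :
    (forall n, exists d e, z = x ^+ n * d + y ^+ n * e) -> z = 0 }.

Local Notation "x %:F" := (tofrac x).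

Lemma frac_numden (R : idomainType) (w : {fraction R}) :
  exists n d : R, d != 0 /\ w * d%:F = n%:F.
Proof.
elim/quotW: w => w; exists \n_w, \d_w; split; first exact: denom_ratioP.
unlock FracField.tofrac; rewrite -[LHS]FracField.pi_mul.
apply/eqmodP; rewrite /= FracField.equivfE /FracField.mulf.
rewrite !numden_Ratio ?mulr1 ?mul1r ?oner_neq0 ?denom_ratioP //.
by rewrite mulrC.
Qed.

Section RegularParameters.
Variables (R : idomainType) (m : set R).
Hypotheses (noethR : noetherian R) (locR : local_ring m) (dimR : krull_dim R 2).
Implicit Types (x y z : R).

Lemma regular_parameters x y : m = ideal_gen [set x; y] -> parameters x y.
Proof.
move=> mE.
have mE' : m = ideal_gen [set y; x].
  by rewrite mE; congr ideal_gen; rewrite setUC.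
have ndx := param_pow_ndiv noethR locR mE dimR.
have ndy := param_pow_ndiv noethR locR mE' dimR.
have mx := param_max1 mE; have my := param_max2 mE.
have krull := krull_local noethR locR.
split.
- move=> c; have [Uc|/negP Uc] := boolP (c \is a GRing.unit); first by left.
  right; apply/(maxP mE); apply: contrapT => mc.
  by apply: Uc; exact: (nonunit_max noethR locR mc).
- by move=> d e de1; apply: (max_proper locR); apply/(maxP mE); exists d, e.
- by apply/eqP => x0; apply: (ndy 1%N); rewrite x0; exists 0; rewrite mulr0.
- by apply/eqP => y0; apply: (ndx 1%N); rewrite y0; exists 0; rewrite mulr0.
- move=> a b xaE; apply: contrapT => /(mod_param noethR locR mE).
  move=> [n [u [c [Uu bE]]]]; apply: (ndx n.+1).
  exists ((a - y * c) * u^-1); rewrite mulrA mulrBr xaE bE.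
  have -> : y * (y ^+ n * u + x * c) - x * (y * c) = y ^+ n.+1 * u.
    by rewrite exprS; ring.
  by rewrite mulrK.
- move=> z zE.
  have xz n : divides (x ^+ n) z.
    apply: (krull _ y) => // [|k]; first exact: divides_ideal.
    have [d [e ->]] := zE (maxn n k).
    exists (x ^+ maxn n k * d).
      by exists (x ^+ (maxn n k - n) * d); rewrite mulrA -exprD subnKC ?leq_maxl.
    by exists (y ^+ (maxn n k - k) * e); rewrite mulrA -exprD subnKC ?leq_maxr.
  have /idealP i0 : [set 0 : R] 0 /\ forall a u v : R,
    [set 0] u -> [set 0] v -> [set 0] (a * u + v).
    by split=> // a _ _ -> ->; rewrite mulr0 addr0.
  apply: (krull _ x z i0) => // n; exists 0 => //.
  by have [c ->] := xz n; exists c; rewrite add0r.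
Qed.

(** A prime ideal other than the maximal ideal omits one of the parameters, so
    it is principal. The largest ideals [(R : c w)] with [c w] not in [R] are
    prime, and they are not the maximal ideal because [x, y] is a regular
    sequence: hence a fraction outside [R] has a prime element in a denominator. *)
Lemma frac_prime_denominator x y (w : {fraction R}) :
  m = ideal_gen [set x; y] -> ~ range (@tofrac R) w ->
  exists f c a, [/\ prime_elem f,
    tofrac c * w * tofrac f = tofrac a & ~ divides f a].
Proof.
move=> mE wR.
have [_ _ x0 _ syz _] := regular_parameters mE.
pose col (c : R) : set R := [set d | range (@tofrac R) ((d * c)%:F * w)].
pose fam := [set J | exists2 c, ~ range (@tofrac R) (c%:F * w) & J = col c].
have colI c : ideal (col c).
  apply/idealP; split; first by exists 0; rewrite // mul0r !rmorph0 mul0r.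
  move=> e u v [u' _ uE] [v' _ vE]; exists (e * u' + v') => //.
  by rewrite rmorphD rmorphM /= uE vE !(mulrDl, rmorphD, rmorphM) /=; ring.
have [||J [c cwR ->] maxJ] := ideal_family_max (F := fam) noethR (J0 := col 1).
- by exists 1; rewrite ?rmorph1 ?mul1r.
- by move=> J [c _ ->].
have primeJ : prime_ideal (col c).
  apply/prime_idealP; split=> // [[a _ aE]|u v [a _ aE]].
    by apply: cwR; exists a; rewrite // aE mul1r.
  have [|ucwR] := pselect (col c u); [by left|right].
  apply: (maxJ (col (u * c))); first by exists (u * c).
    move=> d [b _ bE]; exists (u * b) => //.
    by rewrite rmorphM /= bE !rmorphM /=; ring.
  by exists a; rewrite // aE mulrA [v * u]mulrC.
have [f JE] : exists f, col c = divides f.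
  have [Jx|] := pselect (col c x); last exact: (prime_principal noethR locR mE).
  apply: (prime_principal noethR locR (x := y) (y := x)) => //.
    by rewrite mE; congr ideal_gen; rewrite setUC.
  move: Jx => [a _ aE] [b _ bE].
  have [|d bE'] := syz b a.
    by apply/eqP; rewrite -tofrac_eq !rmorphM /= aE bE !rmorphM /=; apply/eqP; ring.
  apply: cwR; exists d => //; have x0' : x%:F != 0 by rewrite tofrac_eq0.
  by apply: (mulfI x0'); rewrite -tofracM -bE' aE tofracM mulrA.
exists f, c; have [b _ bE] : col c f by rewrite JE; exists 1; rewrite mulr1.
exists b; have fb : c%:F * w * f%:F = b%:F by rewrite bE rmorphM /=; ring.
have f0 : f != 0.
  have [n [d [d0 wd]]] := frac_numden w.
  have : col c d by exists (c * n); rewrite // !rmorphM /= -wd; ring.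
  by rewrite JE => -[e dE]; apply: contra_neq d0 => f0; rewrite dE f0 mul0r.
have /prime_idealP[_ J1 Jp] := primeJ; rewrite JE in J1 Jp; split=> //.
case=> e bE'; apply: cwR; exists e => //.
have f0' : f%:F != 0 by rewrite tofrac_eq0.
by apply: (mulfI f0'); rewrite -tofracM -bE' -fb mulrC.
Qed.

End RegularParameters.

(** * Ideals generated by monomials in a regular system of parameters *)

Section Monomials.
Variables (R : idomainType) (x y : R).
Hypothesis xyP : parameters x y.
Implicit Types (S T U : set (nat * nat)) (e : nat * nat) (z u s : R).

Definition monomial e : R := x ^+ e.1 * y ^+ e.2.

Definition monomial_span S : set R := ideal_gen (monomial @` S).

Definition shift e e' : nat * nat := (e.1 + e'.1, e.2 + e'.2)%N.

Lemma monomialM e e' : monomial e * monomial e' = monomial (shift e e').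
Proof. by rewrite /monomial !exprD; ring. Qed.

Lemma monomial_dvd e e' :
  (e.1 <= e'.1)%N -> (e.2 <= e'.2)%N -> divides (monomial e) (monomial e').
Proof.
move=> le1 le2; exists (monomial (e'.1 - e.1, e'.2 - e.2)%N).
by rewrite monomialM /shift /= !subnKC // -surjective_pairing.
Qed.

Lemma monomial_span_ideal S : ideal (monomial_span S).
Proof. exact: ideal_gen_ideal. Qed.

Lemma monomial_spanD S u v :
  monomial_span S u -> monomial_span S v -> monomial_span S (u + v).
Proof. by apply: idealD; exact: monomial_span_ideal. Qed.

Lemma monomial_spanM S a z : monomial_span S z -> monomial_span S (a * z).
Proof. by apply: idealMl; exact: monomial_span_ideal. Qed.

Lemma monomial_span_sub S J :
  ideal J -> (forall e, S e -> J (monomial e)) -> monomial_span S `<=` J.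
Proof.
by move=> iJ SJ; apply: ideal_gen_min => // _ [e Se <-]; exact: SJ.
Qed.

Lemma monomial_span_in S e : S e -> monomial_span S (monomial e).
Proof. by move=> Se; apply: ideal_gen_in; exists e. Qed.

Lemma monomial_spanS S T : S `<=` T -> monomial_span S `<=` monomial_span T.
Proof.
move=> ST; apply: monomial_span_sub; first exact: monomial_span_ideal.
by move=> e /ST; exact: monomial_span_in.
Qed.

Lemma monomial_span_mul S T U z t :
  (forall e e', S e -> T e' -> U (shift e e')) ->
  monomial_span S z -> monomial_span T t -> monomial_span U (z * t).
Proof.
move=> STU Sz Tt.
have iU := monomial_span_ideal U.
move: z Sz; apply: (monomial_span_sub (J := [set z | monomial_span U (z * t)])).
  apply/idealP; split; first by rewrite /= mul0r; exact: ideal0.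
  by move=> a u v /= Uu Uv; rewrite mulrDl -mulrA; apply: idealD => //; exact: idealMl.
move=> e Se; move: t Tt; rewrite /=.
apply: (monomial_span_sub (J := [set t | monomial_span U (monomial e * t)])).
  apply/idealP; split; first by rewrite /= mulr0; exact: ideal0.
  move=> a u v /= Uu Uv; rewrite mulrDr mulrCA.
  by apply: idealD => //; exact: idealMl.
by move=> e' Te' /=; rewrite monomialM; apply: monomial_span_in; exact: STU.
Qed.

Lemma xpow_dvd_cancel n j z : divides (x ^+ n) (y ^+ j * z) -> divides (x ^+ n) z.
Proof.
have ycancel k t : divides (x ^+ k) (y * t) -> divides (x ^+ k) t.
  elim: k t => [|k IH] t [c ytE]; first by exists t; rewrite mul1r.
  have [|d tE] := param_syz xyP (a := x ^+ k * c) (b := t).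
    by rewrite ytE exprS mulrA.
  have [|d' dE] := IH d; last by exists d'; rewrite tE dE exprS mulrA.
  exists c; apply: (mulfI (param_neq0l xyP)).
  by rewrite [RHS]mulrA -exprS -ytE tE; ring.
elim: j => [|j IH]; first by rewrite mul1r.
by rewrite exprS -mulrA => /ycancel.
Qed.

(** Otherwise the monomial lies in [(x^(i+1)) + (y^(j+1))], which is impossible
    because [x, y] is a regular sequence in the maximal ideal. *)
Lemma monomial_in_span S e :
  monomial_span S (monomial e) ->
  exists e', [/\ S e', (e'.1 <= e.1)%N & (e'.2 <= e.2)%N].
Proof.
case: e => i j Se; apply: contrapT => noe'.
have [A [B]] : exists A B, monomial (i, j) = x ^+ i.+1 * A + y ^+ j.+1 * B.
  apply/ideal_gen2; apply: monomial_span_sub Se.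
    exact: ideal_gen_ideal.
  move=> e' Se'; apply/ideal_gen2.
  have [lti|lei] := ltnP i e'.1.
    exists (monomial (e'.1 - i.+1, e'.2)%N), 0.
    by rewrite /monomial /= mulr0 addr0 mulrA -exprD subnKC.
  have [ltj|lej] := ltnP j e'.2.
    exists 0, (monomial (e'.1, e'.2 - j.+1)%N).
    by rewrite /monomial /= mulr0 add0r mulrCA -exprD subnKC.
  by case: noe'; exists e'.
rewrite /monomial /= => E.
have [C CE] : divides (x ^+ i.+1) (x ^+ i - y * B).
  apply: (@xpow_dvd_cancel _ j); exists A.
  have -> : y ^+ j * (x ^+ i - y * B) = x ^+ i * y ^+ j - y ^+ j.+1 * B.
    by rewrite exprS; ring.
  by rewrite E addrK.
have [D BE] : divides (x ^+ i) B.
  apply: (@xpow_dvd_cancel _ 1); exists (1 - x * C).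
  have -> : y ^+ 1 * B = x ^+ i - (x ^+ i - y * B) by ring.
  by rewrite CE exprS; ring.
apply: (param_proper xyP (d := C) (e := D)).
have xi0 : x ^+ i != 0 by rewrite expf_neq0 ?(param_neq0l xyP).
apply: (mulfI xi0); rewrite mulr1.
by rewrite -[RHS](subrK (y * B)) CE BE exprS; ring.
Qed.

Lemma leading_exponent_le S T e u z s :
  u \is a GRing.unit -> z = u * monomial e + s ->
  monomial_span S z -> monomial_span T s ->
  exists e', [/\ S e' \/ T e', (e'.1 <= e.1)%N & (e'.2 <= e.2)%N].
Proof.
move=> Uu zE Sz Ts; apply: (@monomial_in_span (S `|` T)).
rewrite -(mulKr Uu (monomial e)); apply: monomial_spanM.
have -> : u * monomial e = z + -1 * s by rewrite zE; ring.
apply: monomial_spanD; last apply: monomial_spanM.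
  by apply: monomial_spanS Sz => ?; left.
by apply: monomial_spanS Ts => ?; right.
Qed.

Lemma monomial_span_split S T e z :
  (forall e', S e' -> T e' \/ e' = e) -> monomial_span S z ->
  exists c s, z = c * monomial e + s /\ monomial_span T s.
Proof.
move=> ST; move: z; apply: monomial_span_sub.
  apply/idealP; split.
    by exists 0, 0; rewrite mul0r addr0; split=> //; exact: ideal0 (monomial_span_ideal T).
  move=> a _ _ [c [s [-> Ts]]] [d [t [-> Tt]]].
  exists (a * c + d), (a * s + t); split; first by ring.
  by apply: monomial_spanD => //; exact: monomial_spanM.
move=> e' /ST[Te'|->].
  by exists 0, (monomial e'); rewrite mul0r add0r; split=> //; exact: monomial_span_in.
exists 1, 0; rewrite mul1r addr0; split=> //.
exact: ideal0 (monomial_span_ideal T).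
Qed.

(** Leading terms. The monomials outside [S] are discarded one at a time, in
    the order given by [ord]; the first one that cannot be discarded is the
    leading exponent, and its coefficient is a unit because the multiples of
    the monomial by [x] and by [y] have not been discarded yet. *)
Lemma leading_term S (ord : nat * nat -> nat) B z :
  (forall i j, (ord (i, j) < ord (i.+1, j))%N) ->
  (forall i j, (ord (i, j) < ord (i, j.+1))%N) ->
  (forall e e', ~ S e -> ~ S e' -> ord e = ord e' -> e = e') ->
  (forall e, (B <= ord e)%N -> S e) ->
  ~ monomial_span S z ->
  exists e u s, [/\ ~ S e, u \is a GRing.unit, z = u * monomial e + s
    & monomial_span (S `|` [set e' | ord e < ord e']%N) s].
Proof.
move=> ord1 ord2 ord_inj ordB zS.
pose T k := S `|` [set e' | k <= ord e']%N.
pose P k := `[< ~ monomial_span (T k) z >].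
have exP : exists k, P k.
  exists B; apply/asboolP; apply: contra_not zS; apply: monomial_spanS.
  by move=> e [|/ordB].
have [[|k] /asboolP Tk mink] := ex_minnP exP.
  case: Tk; rewrite -(mulr1 z); apply: monomial_spanM.
  have -> : 1 = monomial (0, 0)%N by rewrite /monomial mulr1.
  by apply: monomial_span_in; right.
have {mink} Tkz : monomial_span (T k) z.
  by apply: contrapT => /asboolP /mink; rewrite ltnn.
have [e [Se ke]] : exists e, ~ S e /\ ord e = k.
  apply: contrapT => noe; apply: Tk; apply: monomial_spanS Tkz => e [Se|/= lek].
    by left.
  have [|Se] := pselect (S e); [by left|right => /=].
  by rewrite ltn_neqAle lek andbT; apply/eqP => ke; apply: noe; exists e.
have [|c [s [zE Ts]]] := @monomial_span_split (T k) (T k.+1) e z _ Tkz.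
  move=> e' [Se'|/=]; first by left; left.
  rewrite leq_eqVlt => /orP[/eqP ke'|]; last by left; right.
  have [|Se'] := pselect (S e'); first by left; left.
  by right; apply: ord_inj => //; rewrite ke -ke'.
exists e, c, s; split=> //; last by rewrite ke.
case: (param_local xyP c) => // -[a [b cE]]; case: Tk.
rewrite zE; apply: monomial_spanD => //; rewrite cE.
have -> : (x * a + y * b) * monomial e =
    a * monomial (e.1.+1, e.2) + b * monomial (e.1, e.2.+1).
  by rewrite /monomial /= !exprS; ring.
by apply: monomial_spanD; apply: monomial_spanM; apply: monomial_span_in; right;
  rewrite /= -ke {1}[e]surjective_pairing.
Qed.

End Monomials.

(** * Valuations from filtrations *)

Section FiltrationValuation.
Variable R : idomainType.
Local Notation K := {fraction R}.
Implicit Types (z t : R) (w : K) (k l : nat).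

(** [F k] plays the role of the elements of value at least [k]. *)
Record valuation_filtration (F : nat -> set R) : Prop := ValuationFiltration {
  vfilt0 z : F 0%N z;
  vfilt_zero k : F k 0;
  vfiltS k : F k.+1 `<=` F k;
  vfiltD k u v : F k u -> F k v -> F k (u + v);
  vfilt_sep z : (forall k, F k z) -> z = 0;
  vfiltM k l z t : F k z -> ~ F k.+1 z -> F l t -> ~ F l.+1 t ->
    F (k + l)%N (z * t) /\ ~ F (k + l).+1 (z * t);
  vfilt_step : exists k s t,
    [/\ F k.+1 s, ~ F k.+2 s, F k t & ~ F k.+1 t] }.

Variables (F : nat -> set R) (fF : valuation_filtration F).

Lemma vfilt_mono k l : (k <= l)%N -> F l `<=` F k.
Proof.
move=> /subnK <-; elim: (l - k)%N => // n IH z /(vfiltS fF); exact: IH.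
Qed.

(** The value of [z] is the largest [k] such that [F k] contains [z]; it extends
    to fractions by subtraction, and it takes the value one by [vfilt_step]. *)
Lemma filtration_valuation :
  exists2 v : K -> int, discrete_valuation v
    & forall z k, z != 0 -> F k z <-> (k%:Z <= v z%:F).
Proof.
have ex_lev z : exists k, z != 0 -> F k z /\ ~ F k.+1 z.
  have [->|z0] := eqVneq z 0; first by exists 0%N => /eqP.
  have exN : exists k, ~~ `[< F k z >].
    apply: contrapT => noN; move/eqP: z0; apply; apply: (vfilt_sep fF) => k.
    by apply: contrapT => Fk; apply: noN; exists k; apply/negP => /asboolP.
  have [[|k] Fk mink] := ex_minnP exN.
    by case/negP: Fk; apply/asboolP/(vfilt0 fF).
  exists k => _; split; last by move=> /asboolP; exact/negP.
  by apply: contrapT => /asboolPn /mink; rewrite ltnn.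
have [lev levP] := choice ex_lev.
have lev_ge z k : z != 0 -> F k z <-> (k <= lev z)%N.
  move=> /levP[Fl Fl1]; split=> [Fk|lek]; last exact: vfilt_mono Fl.
  by rewrite leqNgt; apply/negP => ltk; apply: Fl1; exact: vfilt_mono Fk.
have lev_eq z k : z != 0 -> F k z -> ~ F k.+1 z -> lev z = k.
  move=> z0 /(lev_ge _ _ z0) le1 Fk1; apply/eqP; rewrite eqn_leq le1 andbT leqNgt.
  by apply/negP => /(lev_ge _ _ z0).
have levM z t : z != 0 -> t != 0 -> lev (z * t) = (lev z + lev t)%N.
  move=> z0 t0; have [Fz Fz1] := levP _ z0; have [Ft Ft1] := levP _ t0.
  by have [] := vfiltM fF Fz Fz1 Ft Ft1; apply: lev_eq; rewrite mulf_neq0.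
have [nd ndP] : exists nd : K -> R * R,
    forall w, (nd w).2 != 0 /\ w * (nd w).2%:F = (nd w).1%:F.
  have [|nd ndP] := choice (P := fun (w : K) (nd : R * R) =>
    nd.2 != 0 /\ w * nd.2%:F = nd.1%:F); last by exists nd.
  by move=> w; have [n [d []]] := frac_numden w; exists (n, d).
pose v w : int := (lev (nd w).1)%:Z - (lev (nd w).2)%:Z.
have num0 w n d : w != 0 -> d != 0 -> w * d%:F = n%:F -> n != 0.
  by move=> w0 d0 wd; rewrite -tofrac_eq0 -wd mulf_neq0 ?tofrac_eq0.
have vE w n d : w != 0 -> d != 0 -> w * d%:F = n%:F ->
    v w = (lev n)%:Z - (lev d)%:Z.
  move=> w0 d0 wd; have n0 := num0 _ _ _ w0 d0 wd.
  have [d0' wd'] := ndP w; have n0' := num0 _ _ _ w0 d0' wd'.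
  rewrite /v; have: lev (n * (nd w).2) = lev ((nd w).1 * d).
    congr lev; apply/eqP; rewrite -tofrac_eq !tofracM -wd -wd'.
    by apply/eqP; ring.
  by rewrite !levM //; lia.
have vM a b : a != 0 -> b != 0 -> v (a * b) = v a + v b.
  move=> a0 b0; have [da0 ad] := ndP a; have [db0 bd] := ndP b.
  have na := num0 _ _ _ a0 da0 ad; have nb := num0 _ _ _ b0 db0 bd.
  rewrite (vE (a * b) ((nd a).1 * (nd b).1) ((nd a).2 * (nd b).2)).
  - by rewrite !levM // /v !PoszD; ring.
  - by rewrite mulf_neq0.
  - by rewrite mulf_neq0.
  - by rewrite !tofracM -ad -bd; ring.
have v1 : v 1 = 0.
  have := vM 1 1 (oner_neq0 _) (oner_neq0 _); rewrite mulr1 => /eqP.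
  by rewrite -subr_eq subrr eq_sym => /eqP.
have vF z : z != 0 -> v z%:F = (lev z)%:Z.
  move=> z0; rewrite (vE _ z 1) ?tofrac_eq0 ?oner_neq0 ?tofrac1 ?mulr1 //.
  suff -> : lev 1 = 0%N by rewrite subr0.
  by have := levM 1 1 (oner_neq0 _) (oner_neq0 _); rewrite mulr1; lia.
exists v; last by move=> z k z0; rewrite vF // lez_nat; exact: lev_ge.
split=> // [a b a0 b0 ab0|k].
  have [da0 ad] := ndP a; have [db0 bd] := ndP b.
  have na := num0 _ _ _ a0 da0 ad; have nb := num0 _ _ _ b0 db0 bd.
  have abd : (a + b) * ((nd a).2 * (nd b).2)%:F =
      ((nd a).1 * (nd b).2 + (nd b).1 * (nd a).2)%:F.
    by rewrite tofracD !tofracM -ad -bd; ring.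
  have d0 : (nd a).2 * (nd b).2 != 0 by rewrite mulf_neq0.
  have n0 := num0 _ _ _ ab0 d0 abd.
  rewrite (vE _ _ _ ab0 d0 abd) levM // /v.
  set l := minn (lev ((nd a).1 * (nd b).2)) (lev ((nd b).1 * (nd a).2)).
  have : leq l (lev ((nd a).1 * (nd b).2 + (nd b).1 * (nd a).2)).
    apply/(lev_ge _ _ n0)/(vfiltD fF); apply/lev_ge;
      by rewrite ?mulf_neq0 // /l ?geq_minl ?geq_minr.
  by rewrite /l !levM //; lia.
have [l [s [t [Fs Fs1 Ft Ft1]]]] := vfilt_step fF.
have s0 : s != 0 by apply/eqP => s0; apply: Fs1; rewrite s0; exact: vfilt_zero.
have t0 : t != 0 by apply/eqP => t0; apply: Ft1; rewrite t0; exact: vfilt_zero.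
pose w := s%:F / t%:F.
have w0 : w != 0 by rewrite mulf_neq0 ?invr_eq0 ?tofrac_eq0.
have vw : v w = 1.
  rewrite (vE _ s t) // /w ?divfK ?tofrac_eq0 //.
  by rewrite (lev_eq s l.+1) // (lev_eq t l) // -addn1 PoszD addrAC subrr.
have vX n : v (w ^+ n) = n%:Z.
  elim: n => [|n IH]; first by rewrite expr0.
  by rewrite exprS vM ?expf_neq0 // vw IH -addn1 PoszD addrC.
case: k => n; first by exists (w ^+ n); rewrite ?expf_neq0 ?vX.
exists (w ^+ n.+1)^-1; first by rewrite invr_eq0 expf_neq0.
have wn0 : w ^+ n.+1 != 0 by rewrite expf_neq0.
have wi0 : (w ^+ n.+1)^-1 != 0 by rewrite invr_eq0.
by have := vM _ _ wn0 wi0; rewrite divff // v1 vX NegzE; lia.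
Qed.

End FiltrationValuation.

(** * Valuative closure of monomial ideals *)

Definition valuation_ring (K : fieldType) (v : K -> int) : set K :=
  [set a | a = 0 \/ 0 <= v a].

Lemma valuation_ideal_closed (K : fieldType) (v : K -> int) (k : int) :
  discrete_valuation v ->
  forall c a b : K, valuation_ring v c ->
    (a = 0 \/ k <= v a) -> (b = 0 \/ k <= v b) ->
    c * a + b = 0 \/ k <= v (c * a + b).
Proof.
move=> [vM vD _] c a b Vc ka kb.
have kca : c * a = 0 \/ k <= v (c * a).
  have [->|c0] := eqVneq c 0; first by left; rewrite mul0r.
  have [->|a0] := eqVneq a 0; first by left; rewrite mulr0.
  right; rewrite vM //.
  case: Vc => [/eqP|Vc]; first by rewrite (negbTE c0).
  by case: ka => [/eqP|ka]; [rewrite (negbTE a0)|lia].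
have [->|ca0] := eqVneq (c * a) 0; first by rewrite add0r.
have [->|b0] := eqVneq b 0; first by rewrite addr0.
have [|ab0] := eqVneq (c * a + b) 0; [by left|right].
case: kca => [/eqP|kca]; first by rewrite (negbTE ca0).
case: kb => [/eqP|kb]; first by rewrite (negbTE b0).
by apply: le_trans (vD _ _ ca0 b0 ab0); rewrite le_min kca.
Qed.

Lemma lspan_valuation (K : fieldType) (v : K -> int) (k : int) (X : set K) :
  discrete_valuation v -> (forall a, X a -> a = 0 \/ k <= v a) ->
  forall a, lspan (valuation_ring v) (X : set K^o) a -> a = 0 \/ k <= v a.
Proof.
move=> vP XP _ [n [c [u [Vc Xu ->]]]].
elim/big_rec: _ => [|i a _ IH]; first by left.
exact: (valuation_ideal_closed vP (Vc i) (XP _ (Xu i)) IH).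
Qed.

Section ValuativeClosure.
Variable R : idomainType.
Local Notation K := {fraction R}.
Implicit Types (J : set R) (z : R) (w : K).

(** In a noetherian normal domain this is the valuative description of the
    integral closure of [J]. *)
Definition valuatively_in J w : Prop :=
  forall V : set K, dvr_of V -> range (@tofrac R) `<=` V ->
    lspan V ((@tofrac R) @` J : set K^o) w.

Lemma valuatively_in_filtration (F : nat -> set R) k J z :
  valuation_filtration F -> J `<=` F k -> valuatively_in J z%:F -> F k z.
Proof.
move=> fF JF Jz; have [v vP vF] := filtration_valuation fF.
have [->|z0] := eqVneq z 0; first exact: vfilt_zero.
have RV : range (@tofrac R) `<=` valuation_ring v.
  move=> _ [c _ <-]; have [->|c0] := eqVneq c 0; first by left; rewrite tofrac0.
  by right; apply/vF => //; exact: vfilt0.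
have kJ w : ((@tofrac R) @` J) w -> w = 0 \/ k%:Z <= v w.
  move=> [c /JF Fc <-]; have [->|c0] := eqVneq c 0; first by left; rewrite tofrac0.
  by right; apply/vF.
have := lspan_valuation vP kJ (Jz _ (ex_intro2 _ _ v vP erefl) RV).
by case=> [/eqP|/vF]; [rewrite tofrac_eq0 (negbTE z0)|exact].
Qed.

(** Separation is Krull's theorem for the powers of [f], and values add up
    because [f] is prime. *)
Lemma prime_elem_filtration (f : R) :
  noetherian R -> prime_elem f ->
  valuation_filtration (fun k => divides (f ^+ k)).
Proof.
move=> noethR [f0 f1 fp]; have fn0 n : f ^+ n != 0 by rewrite expf_neq0.
split.
- by move=> z; exists z; rewrite mul1r.
- by move=> k; exact: ideal0 (divides_ideal _).
- by move=> k _ [c ->]; exists (f * c); rewrite exprSr mulrA.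
- by move=> k u v; apply: idealD; exact: divides_ideal.
- move=> z fz.
  have i0 : ideal [set 0 : R].
    by apply/idealP; split=> // a _ _ -> ->; rewrite mulr0 addr0.
  have [n|c] := krull_intersection noethR (t := f) (a := z) i0.
    by exists 0 => //; have [d ->] := fz n; exists d; rewrite add0r.
  move/eqP; rewrite mulf_eq0 subr_eq0 => /orP[/eqP fc|/eqP //].
  by case: f1; exists c.
- move=> k l _ _ [z ->] fz [t ->] ft; split.
    by exists (z * t); rewrite exprD; ring.
  case=> c; rewrite exprSr exprD => E.
  have [|[d zE]|[d tE]] := fp z t.
  + exists c; apply: (mulfI (mulf_neq0 (fn0 k) (fn0 l))).
    by rewrite !mulrA -E; ring.
  + by case: fz; exists d; rewrite zE exprSr mulrA.
  + by case: ft; exists d; rewrite tE exprSr mulrA.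
- exists 0%N, f, 1; split; first by exists 1; rewrite mulr1.
  + case=> c; rewrite expr2 -mulrA -{1}[f]mulr1 => /(mulfI f0) E.
    by case: f1; exists c.
  + by exists 1; rewrite mulr1.
  + by rewrite expr1.
Qed.

(** A fraction outside [R] has a multiple by an element of [R] whose denominator
    is a prime element, and the valuation of this prime is negative on both. *)
Lemma valuatively_integral (m : set R) x y w :
  noetherian R -> local_ring m -> krull_dim R 2 -> m = ideal_gen [set x; y] ->
  (forall V : set K, dvr_of V -> range (@tofrac R) `<=` V -> V w) ->
  range (@tofrac R) w.
Proof.
move=> noethR locR dimR mE wV; apply: contrapT => wR.
have [f [c [a [pf fE fa]]]] := frac_prime_denominator noethR locR dimR mE wR.
apply: fa; have [f0 _ _] := pf; rewrite -[f]expr1.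
apply: (valuatively_in_filtration (prime_elem_filtration noethR pf)
  (J := divides f)) => [|V Vdvr RV]; first by rewrite expr1.
exists 1%N, (fun=> c%:F * w), (fun=> f%:F); split.
- move=> _; case: (Vdvr) (wV V Vdvr RV) (RV c%:F (ex_intro2 _ _ c I erefl)).
  move=> v vP -> wv cv; rewrite -[_ * _]addr0.
  by apply: (valuation_ideal_closed vP cv wv); left.
- by move=> _; exists f => //; exists 1; rewrite mulr1.
- by rewrite big_ord1 -fE.
Qed.

Variables (x y : R).
Hypothesis xyP : parameters x y.

Definition weight (p q : nat) (e : nat * nat) : nat := (p * e.1 + q * e.2)%N.

Arguments weight : simpl never.

Lemma weight_shift p q e e' :
  weight p q (shift e e') = (weight p q e + weight p q e')%N.
Proof. by rewrite /weight /shift /=; ring. Qed.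

Lemma weight_le p q e e' :
  (e'.1 <= e.1)%N -> (e'.2 <= e.2)%N -> (weight p q e' <= weight p q e)%N.
Proof. by move=> le1 le2; rewrite leq_add // leq_mul. Qed.

Definition weight_span p q k : set R :=
  monomial_span x y [set e | (k <= weight p q e)%N].

(** The leading term of an element for the order by weight, then by the
    exponent of [x], which is compatible with multiplication. *)
Lemma weight_leading_term p q k z :
  (0 < p)%N -> (0 < q)%N ->
  weight_span p q k z -> ~ weight_span p q k.+1 z ->
  exists e u s, [/\ weight p q e = k, u \is a GRing.unit,
    z = u * monomial x y e + s
    & monomial_span x y [set e' | (k < weight p q e')%N \/
        (weight p q e' = k /\ (e.1 < e'.1)%N)] s].
Proof.
move=> p0 q0 zk zk1.
(* A monomial of weight at most [k] has exponent of [x] less than [k + 2], so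
   that this number orders them lexicographically by weight and exponent. *)
pose ord e := (weight p q e * k.+2 + e.1)%N.
have lex e : ~ (k < weight p q e)%N -> (e.1 <= k)%N.
  by move=> /negP; rewrite -leqNgt /weight => le; nia.
have [||||e [u [s [Se Uu zE Ts]]]] :=
  leading_term xyP (S := [set e | (k < weight p q e)%N]) (ord := ord)
    (B := (k.+1 * k.+2)%N) _ _ _ _ zk1.
- by move=> i j; rewrite /ord /weight /=; nia.
- by move=> i j; rewrite /ord /weight /=; nia.
- move=> [i j] [i' j'] /= /lex lei /lex lei'; rewrite /ord /= in lei lei' * => E.
  have ii' : i = i'.
    have := congr1 (modn^~ k.+2) E.
    by rewrite /= !modnMDl !modn_small //; lia.
  have : weight p q (i, j) = weight p q (i', j') by rewrite ii' in E *; nia.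
  by rewrite /weight /= ii' => {}E; congr pair => //; nia.
- by move=> e /=; rewrite /ord => le; apply: contrapT => /[dup] /lex; nia.
have le_e : (weight p q e <= k)%N by rewrite leqNgt; apply/negP.
have kE : weight p q e = k.
  have [e' [Te' le1 le2]] := leading_exponent_le xyP Uu zE zk Ts.
  have le_w := weight_le p q le1 le2.
  have le_ord : (ord e' <= ord e)%N by rewrite leq_add // leq_mul.
  by case: Te' => [|[]] /=; lia.
exists e, u, s; split=> //; apply: monomial_spanS Ts => e' [|/=]; first by left.
rewrite /ord kE => lt_ord.
have [|/negP nlt] := boolP (k < weight p q e')%N; [by left|right].
have le_e' : (weight p q e' <= k)%N by rewrite leqNgt; apply/negP.
by have := lex e' nlt; nia.
Qed.

(** Values add up because the leading terms of two elements multiply to the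
    leading term of their product. As [p] and [q] are coprime, some power of [x]
    has value one more than some power of [y]. *)
Lemma weight_filtration p q :
  (0 < p)%N -> (0 < q)%N -> coprime p q ->
  valuation_filtration (weight_span p q).
Proof.
move=> p0 q0 pq.
have spanS k : weight_span p q k.+1 `<=` weight_span p q k.
  by apply: monomial_spanS => e /=; exact: ltnW.
have mono_weight e k : weight_span p q k (monomial x y e) <-> (k <= weight p q e)%N.
  split=> [/(monomial_in_span xyP)[e' [/= ]]|]; last exact: monomial_span_in.
  by move=> le le1 le2; apply: leq_trans le _; exact: weight_le.
split=> //.
- move=> z; rewrite -(mulr1 z); apply: monomial_spanM.
  have -> : 1 = monomial x y (0, 0)%N by rewrite /monomial mulr1.
  exact: monomial_span_in.
- by move=> k; exact: ideal0 (monomial_span_ideal _ _ _).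
- by move=> k u v; exact: monomial_spanD.
- move=> z zF; apply: (param_sep xyP) => n; apply/ideal_gen2.
  apply: monomial_span_sub (zF (n * (p + q))%N); first exact: ideal_gen_ideal.
  move=> e /= le_e; apply/ideal_gen2; have [len|ltn] := leqP n e.1.
    exists (monomial x y (e.1 - n, e.2)%N), 0.
    by rewrite /monomial /= mulr0 addr0 mulrA -exprD subnKC.
  have len : (n <= e.2)%N by rewrite /weight in le_e; nia.
  exists 0, (monomial x y (e.1, e.2 - n)%N).
  by rewrite /monomial /= mulr0 add0r mulrCA -exprD subnKC.
- move=> k l z t zk zk1 tl tl1; split.
    apply: monomial_span_mul zk tl => e e' /= le le'.
    by rewrite weight_shift leq_add.
  have [e [u [s [eE Uu zE Ts]]]] := weight_leading_term p0 q0 zk zk1.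
  have [e' [u' [s' [eE' Uu' tE Ts']]]] := weight_leading_term p0 q0 tl tl1.
  move=> ztkl; pose T := [set d | (k + l < weight p q d)%N \/
    (weight p q d = k + l /\ ((shift e e').1 < d.1))%N].
  have [|||d [Td le1 le2]] := leading_exponent_le xyP (T := T) (e := shift e e')
      (u := u * u') (s := u * monomial x y e * s' + s * t) _ _ ztkl.
  + by rewrite unitrM Uu.
  + by rewrite -monomialM {1}zE tE; ring.
  + apply: monomial_spanD.
      rewrite -mulrA; apply: monomial_spanM.
      apply: (monomial_span_mul (S := [set e])) Ts'; last exact: monomial_span_in.
      move=> _ d ->; rewrite /T /= weight_shift eE /shift /=; lia.
    have tT : monomial_span x y [set d | (l < weight p q d)%N \/
        (weight p q d = l /\ (e'.1 <= d.1)%N)] t.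
      rewrite tE; apply: monomial_spanD.
        by apply: monomial_spanM; apply: monomial_span_in; right.
      by apply: monomial_spanS Ts' => d /= [|[dl /ltnW]]; [left|right].
    apply: (monomial_span_mul _ Ts) tT => d d' /=.
    rewrite /T /= weight_shift /shift /=; lia.
  + have : (weight p q d <= k + l)%N.
      by rewrite -eE -eE' -weight_shift; exact: weight_le.
    case: Td => [zT|]; first by move: zT; rewrite /= ltnNge => /negP.
    by case=> [|[_]]; rewrite ltnNge => /negP // /(_ le1).
- have [i j ijE _] := egcdnP q p0; rewrite (eqP pq) in ijE.
  exists (q * j)%N, (x ^+ i), (y ^+ j).
  have xE : x ^+ i = monomial x y (i, 0)%N by rewrite /monomial mulr1.
  have yE : y ^+ j = monomial x y (0, j)%N by rewrite /monomial mul1r.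
  rewrite xE yE; split.
  + by apply/mono_weight; rewrite /weight /=; lia.
  + by move/mono_weight; rewrite /weight /=; lia.
  + by apply/mono_weight; rewrite /weight /=; lia.
  + by move/mono_weight; rewrite /weight /=; lia.
Qed.

(** A monomial ideal is the intersection of its extensions to the monomial
    valuation rings as soon as every monomial outside it is separated from it by
    a weight: the leading exponent of an element outside the ideal bounds the
    value of that element for every weight. *)
Lemma valuatively_in_monomial_span (S : set (nat * nat)) N z :
  (forall e e', S e -> (e.1 <= e'.1)%N -> (e.2 <= e'.2)%N -> S e') ->
  (forall e, (N <= e.1)%N || (N <= e.2)%N -> S e) ->
  (forall e, ~ S e -> exists p q, [/\ (0 < p)%N, (0 < q)%N, coprime p q
     & forall e', S e' -> (weight p q e < weight p q e')%N]) ->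
  valuatively_in (monomial_span x y S) z%:F -> monomial_span x y S z.
Proof.
move=> upS SN sepS Sz; apply: contrapT => nSz.
(* Outside [S] both exponents are at most [N]; the order is lexicographic. *)
have lt_box e : ~ S e -> (e.1 < N.+1)%N /\ (e.2 < N.+1)%N.
  by move=> Se; split; rewrite ltnS leqNgt; apply/negP => /ltnW lt;
    apply: Se; apply: SN; rewrite lt ?orbT.
pose ord (e : nat * nat) := (e.1 * N.+1 + e.2)%N.
have [||||e [u [s [Se Uu zE Ts]]]] :=
  leading_term xyP (ord := ord) (B := (N.+1 * N.+1)%N) _ _ _ _ nSz.
- by move=> i j; rewrite /ord /=; nia.
- by move=> i j; rewrite /ord /=; lia.
- move=> [i j] [i' j'] /lt_box[/= lti ltj] /lt_box[/= lti' ltj'].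
  rewrite /ord /= => E; have jj' : j = j'.
    by have := congr1 (modn^~ N.+1) E; rewrite /= !modnMDl !modn_small.
  by congr pair => //; move: E; rewrite jj'; nia.
- move=> e; rewrite /ord => le; apply: contrapT => /lt_box[]; nia.
have [p [q [p0 q0 pq lt_e]]] := sepS _ Se.
have zF : weight_span p q (weight p q e).+1 z.
  apply: (valuatively_in_filtration (weight_filtration p0 q0 pq) _ Sz).
  by apply: monomial_spanS => e' /lt_e.
have [e' [Te' le1 le2]] := leading_exponent_le xyP Uu zE zF Ts.
have le_w := weight_le p q le1 le2.
have le_ord : (ord e' <= ord e)%N by rewrite leq_add // leq_mul.
case: Te' => [/=|[Se'|/=]]; [by lia| |by lia].
by apply: Se; exact: upS le1 le2.
Qed.

End ValuativeClosure.

(** * Complete monomial ideals and Newton polygons *)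

Lemma max_slope (s : seq (nat * nat)) d :
  (forall e, e \in d :: s -> (0 < e.2)%N) ->
  exists2 e, e \in d :: s
    & forall e', e' \in d :: s -> (e'.1 * e.2 <= e.1 * e'.2)%N.
Proof.
elim: s d => [|c s IH] d pos.
  by exists d; rewrite ?inE // => e'; rewrite inE => /eqP ->.
have [|e es emax] := IH c; first by move=> e es; apply: pos; rewrite inE es orbT.
have e2 : (0 < e.2)%N by apply: pos; rewrite inE es orbT.
have d2 : (0 < d.2)%N by apply: pos; rewrite inE eqxx.
have [le_de|lt_ed] := leqP (d.1 * e.2) (e.1 * d.2).
  exists e; first by rewrite inE es orbT.
  by move=> e'; rewrite inE => /orP[/eqP->|/emax].
exists d; first by rewrite inE eqxx.
move=> e'; rewrite inE => /orP[/eqP->|/emax le_e'e] //.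
rewrite -(leq_pmul2r e2).
have h1 : (e'.1 * e.2 * d.2 <= e.1 * e'.2 * d.2)%N by rewrite leq_mul.
have h2 : (e.1 * d.2 * e'.2 <= d.1 * e.2 * e'.2)%N by rewrite leq_mul // ltnW.
by rewrite mulnAC (leq_trans h1) // mulnAC (leq_trans h2) // mulnAC.
Qed.

(** A pair [(u, v)] stands for the slope [u/v]. The mediant of the largest slope
    of [L] and the smallest slope of [U] lies strictly between them; adjoining
    the slopes [0/1] and [1/0] makes both lists nonempty. *)
Lemma separating_slope (L U : seq (nat * nat)) :
  (forall l, l \in L -> (0 < l.2)%N) -> (forall u, u \in U -> (0 < u.1)%N) ->
  (forall l u, l \in L -> u \in U -> (l.1 * u.2 < u.1 * l.2)%N) ->
  exists p q, [/\ (0 < p)%N, (0 < q)%N, coprime p q,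
    forall l, l \in L -> (l.1 * q < p * l.2)%N
    & forall u, u \in U -> (p * u.2 < u.1 * q)%N].
Proof.
move=> Lpos Upos LU.
have [|l lL lmax] := @max_slope L (0, 1)%N.
  by move=> l; rewrite inE => /orP[/eqP ->|/Lpos].
have [|u' uU umin] := @max_slope [seq (u.2, u.1) | u <- U] (0, 1)%N.
  move=> u; rewrite inE => /orP[/eqP ->|] // /mapP[v vU ->]; exact: Upos.
have {uU} [u uU u'E] : exists2 u, u \in (1, 0)%N :: U & u' = (u.2, u.1).
  move: uU; rewrite inE => /orP[/eqP ->|/mapP[u uU ->]].
    by exists (1, 0)%N; rewrite ?inE.
  by exists u; rewrite // inE uU orbT.
have {}umin v : v \in U -> (v.2 * u.1 <= u.2 * v.1)%N.
  move=> vU; have := umin (v.2, v.1); rewrite u'E /=; apply.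
  by rewrite inE; apply/orP; right; apply: (map_f (fun u => (u.2, u.1))).
have l2 : (0 < l.2)%N by move: lL; rewrite inE => /orP[/eqP ->|/Lpos].
have u1 : (0 < u.1)%N by move: uU; rewrite inE => /orP[/eqP ->|/Upos].
have lu : (l.1 * u.2 < u.1 * l.2)%N.
  move: lL uU; rewrite !inE => /orP[/eqP->|lL] /orP[/eqP->|uU] //=.
  - by rewrite mul0n muln1 Upos.
  - by rewrite muln0 mul1n Lpos.
  - exact: LU.
pose p := (l.1 + u.1)%N; pose q := (l.2 + u.2)%N; pose g := gcdn p q.
have p0 : (0 < p)%N by rewrite /p addn_gt0 u1 orbT.
have q0 : (0 < q)%N by rewrite /q addn_gt0 l2.
have g0 : (0 < g)%N by rewrite gcdn_gt0 p0.
have pE : (p %/ g * g = p)%N by rewrite divnK // dvdn_gcdl.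
have qE : (q %/ g * g = q)%N by rewrite divnK // dvdn_gcdr.
exists (p %/ g)%N, (q %/ g)%N; split.
- by rewrite divn_gt0 // dvdn_leq // dvdn_gcdl.
- by rewrite divn_gt0 // dvdn_leq // dvdn_gcdr.
- rewrite /coprime -(eqn_pmul2r g0) mul1n muln_gcdl pE qE; exact: eqxx.
- move=> l' l'L; rewrite -(ltn_pmul2r g0) -mulnA qE mulnAC pE /p /q.
  have := lmax l'; rewrite inE l'L orbT => /(_ isT).
  have := Lpos _ l'L; move: l2 u1 lu; clear.
  case: l l' u => [l1 l2] [l1' l2'] [u1 u2] /= l2_0 u1_0 lu l2'_0 lmax.
  rewrite -(ltn_pmul2r l2_0).
  have h1 : (l1' * l2 * (l2 + u2) <= l1 * l2' * (l2 + u2))%N by rewrite leq_mul.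
  have h2 : (l1 * u2 * l2' < u1 * l2 * l2')%N by rewrite ltn_pmul2r.
  nia.
- move=> u'' uU''; rewrite -(ltn_pmul2r g0) -[(u''.1 * _ * _)%N]mulnA qE mulnAC pE /p /q.
  have := umin _ uU''; have := Upos _ uU''; move: l2 u1 lu; clear.
  case: l u'' u => [l1 l2] [v1 v2] [u1 u2] /= l2_0 u1_0 lu v1_0 umin.
  rewrite -(ltn_pmul2r u1_0).
  have h1 : (v2 * u1 * (l1 + u1) <= u2 * v1 * (l1 + u1))%N by rewrite leq_mul.
  have h2 : (l1 * u2 * v1 < u1 * l2 * v1)%N by rewrite ltn_pmul2r.
  nia.
Qed.

Section CompleteMonomialIdeal.
Variables (R : idomainType) (x y : R).
Variables (r : nat) (a b : nat -> nat).

Definition staircase : set (nat * nat) :=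
  [set e | exists k, [/\ (k <= r)%N, (a k <= e.1)%N & (b k <= e.2)%N]].

Local Notation I := (monomial_ideal x y r a b).

Lemma monomial_idealE : I = monomial_span x y staircase.
Proof.
apply/seteqP; split.
  apply: ideal_gen_min; first exact: ideal_gen_ideal.
  by move=> _ [k /= kr <-]; apply: (@monomial_span_in _ x y _ (a k, b k)); exists k.
apply: monomial_span_sub; first exact: ideal_gen_ideal.
move=> e [k [kr ka kb]]; have [c ->] := @monomial_dvd _ x y (a k, b k) e ka kb.
by apply: idealMr; [exact: ideal_gen_ideal|apply: ideal_gen_in; exists k].
Qed.

(** The exponent [e] lies above a point of the segment joining those of two
    generators, so the [n]-th power of the monomial is a multiple of a product of
    [n] generators, and the monomial is integral over [I]. *)
Lemma complete_between_gens k l n s e :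
  complete_ideal I -> (k <= r)%N -> (l <= r)%N -> (0 < n)%N -> (s <= n)%N ->
  (s * a l + (n - s) * a k <= n * e.1)%N ->
  (s * b l + (n - s) * b k <= n * e.2)%N ->
  I (monomial x y e).
Proof.
move=> Icomplete kr lr n0 sn le1 le2.
pose gen i := monomial x y (a i, b i).
pose u (i : 'I_n) := if (i < s)%N then gen l else gen k.
have prodE : \prod_i u i = gen l ^+ s * gen k ^+ (n - s).
  rewrite -(big_mkord xpredT (fun i => if (i < s)%N then gen l else gen k)).
  rewrite (big_cat_nat (leq0n s) sn) /=; congr (_ * _).
    rewrite big_nat_cond (eq_bigr (fun=> gen l)); last by move=> i; rewrite /= andbT => ->.
    by rewrite -big_nat_cond prodr_const_nat subn0.
  rewrite big_nat_cond (eq_bigr (fun=> gen k)).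
    by rewrite -big_nat_cond prodr_const_nat.
  by move=> i /andP[/andP[si _] _]; rewrite ltnNge si.
have monX d j : monomial x y d ^+ j = monomial x y (j * d.1, j * d.2)%N.
  by rewrite /monomial exprMn -!exprM ![(j * _)%N]mulnC.
have powE : ideal_pow I n (monomial x y e ^+ n).
  have [c ->] : divides (\prod_i u i) (monomial x y e ^+ n).
    by rewrite prodE !monX monomialM; exact: monomial_dvd.
  apply: idealMr; first exact: ideal_gen_ideal.
  apply: ideal_gen_in; exists u => // i; rewrite /u.
  by case: ifP => _; apply: ideal_gen_in; [exists l|exists k].
apply: Icomplete; exists n, (fun i => if i == n then - monomial x y e ^+ n else 0).
split=> // [i _|].
  case: eqP => [->|_]; last exact: ideal0 (ideal_gen_ideal _).
  by apply: idealN => //; exact: ideal_gen_ideal.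
rewrite big_nat_recr //= eqxx subnn expr0 mulr1 big_nat_cond big1 ?add0r ?subrr //.
by move=> i /andP[/andP[_ ilt] _]; rewrite ltn_eqF // mul0r.
Qed.

Hypothesis xyP : parameters x y.
Hypothesis Icomplete : complete_ideal I.

(** A separating line through [e] has to pass strictly below each generator.
    The generators to the right of [e] bound its slope on one side, the others on
    the other side, and incompatible bounds would place [e] above the segment
    joining two generators, hence in [I] by completeness. *)
Lemma complete_separated e :
  ~ staircase e -> exists p q, [/\ (0 < p)%N, (0 < q)%N, coprime p q
    & forall e', staircase e' -> (weight p q e < weight p q e')%N].
Proof.
case: e => i j nSe.
have above k : (k <= r)%N -> (a k <= i)%N -> (j < b k)%N.
  by move=> kr ai; rewrite ltnNge; apply/negP => bj; apply: nSe; exists k.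
pose L := [seq (j - b k, a k - i)%N | k <- iota 0 r.+1 & (i < a k)%N].
pose U := [seq (b k - j, i - a k)%N | k <- iota 0 r.+1 & (a k <= i)%N].
have [|||p [q [p0 q0 pq Lp Up]]] := @separating_slope L U.
- by move=> l' /mapP[k]; rewrite mem_filter => /andP[ik _] -> /=; rewrite subn_gt0.
- move=> u' /mapP[k]; rewrite mem_filter mem_iota ltnS => /andP[ki kr] -> /=.
  by rewrite subn_gt0 above.
- move=> l' u' /mapP[l lL ->] /mapP[k kU ->] /=; move: lL kU.
  rewrite !mem_filter !mem_iota !ltnS => /andP[il lr] /andP[ki kr].
  rewrite ltnNge; apply/negP => le; apply: nSe.
  have jb := above k kr ki.
  suff /(monomial_in_span xyP)[[i' j'] [[k' [k'r ai' bj']] le1 le2]] :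
      monomial_span x y staircase (monomial x y (i, j)).
    by exists k'; split; rewrite // (leq_trans _ le1, leq_trans _ le2).
  rewrite -monomial_idealE.
  have [s iE] : exists s, i = (a k + s)%N by exists (i - a k)%N; lia.
  have [t alE] : exists t, a l = (i + t)%N by exists (a l - i)%N; lia.
  have [v bkE] : exists v, b k = (j + v)%N by exists (b k - j)%N; lia.
  move: le il jb; rewrite alE bkE addKn {3}iE !addKn => le il jb.
  apply: (@complete_between_gens k l (s + t) s) => //=; lia.
exists p, q; split=> // e' [k [kr ak bk]].
apply: (@leq_trans (weight p q (a k, b k))); last exact: weight_le.
rewrite /weight /=; have [ik|ki] := ltnP i (a k).
  have /Lp /= : (j - b k, a k - i)%N \in L.
    by apply/mapP; exists k; rewrite // mem_filter ik mem_iota /= ltnS.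
  by nia.
have /Up /= : (b k - j, i - a k)%N \in U.
  by apply/mapP; exists k; rewrite // mem_filter ki mem_iota /= ltnS.
have := above k kr ki; nia.
Qed.

Hypotheses (a_r : a r = 0%N) (b_0 : b 0%N = 0%N).

Lemma valuatively_in_complete z : valuatively_in I z%:F -> I z.
Proof.
rewrite monomial_idealE; apply: (valuatively_in_monomial_span xyP (N := a 0 + b r)).
- move=> e e' [k [kr ak bk]] le1 le2.
  by exists k; split; rewrite // (leq_trans _ le1, leq_trans _ le2).
- by move=> e /orP[le|le]; [exists 0%N|exists r]; rewrite ?a_r ?b_0; split=> //; lia.
- exact: complete_separated.
Qed.

End CompleteMonomialIdeal.

(** * The module and its minors *)

Lemma sum_ord2 (V : nmodType) (F : 'I_2 -> V) : \sum_i F i = F 0 + F 1.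
Proof.
rewrite !big_ord_recl big_ord0 addr0; congr (F _ + F _); exact: val_inj.
Qed.

Section PlaneVectors.
Variable R : comNzRingType.
Implicit Types (u v w : 'cV[R]_2).

Definition vec (p q : R) : 'cV[R]_2 := \col_j (if j == 0 then p else q).

Lemma vec0E p q : vec p q 0 0 = p.
Proof. by rewrite mxE. Qed.

Lemma vec1E p q : vec p q 1 0 = q.
Proof. by rewrite mxE. Qed.

Lemma colvec2P u v : u 0 0 = v 0 0 -> u 1 0 = v 1 0 -> u = v.
Proof.
move=> uv0 uv1; apply/colP => -[[|[|//]] lti].
- by rewrite (_ : Ordinal lti = 0) //; apply: val_inj.
- by rewrite (_ : Ordinal lti = 1) //; apply: val_inj.
Qed.

Definition wedge u v : R := u 0 0 * v 1 0 - u 1 0 * v 0 0.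

Lemma wedgeC u v : wedge u v = - wedge v u.
Proof. by rewrite /wedge; ring. Qed.

Lemma wedgePl (a : R) u v w : wedge (a *: u + v) w = a * wedge u w + wedge v w.
Proof. by rewrite /wedge !mxE; ring. Qed.

Lemma wedgePr (a : R) u v w : wedge w (a *: u + v) = a * wedge w u + wedge w v.
Proof. by rewrite /wedge !mxE; ring. Qed.

Lemma wedgeZr (a : R) u w : wedge w (a *: u) = a * wedge w u.
Proof. by rewrite /wedge !mxE; ring. Qed.

(** Three vectors of the plane are linearly dependent. *)
Lemma wedge_cramer u v w :
  wedge u v *: w = wedge w v *: u + wedge u w *: v.
Proof. by apply: colvec2P; rewrite !mxE /wedge; ring. Qed.

End PlaneVectors.

Lemma lspan_image (K : fieldType) n (V : set K) (l : 'cV[K]_n -> K)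
    (X : set 'cV[K]_n) f :
  (forall c u v, l (c *: u + v) = c * l u + l v) ->
  lspan V X f -> lspan V (l @` X : set K^o) (l f).
Proof.
move=> lP [k [c [u [Vc Xu ->]]]]; exists k, c, (fun i => l (u i)); split=> //.
  by move=> i; exists (u i).
have l0 : l 0 = 0 by have := lP (-1) 0 0; rewrite scaler0 addr0 mulN1r addNr.
by elim/big_rec2: _ => // i t v _ <-; rewrite lP.
Qed.

Section Exponents.
Variables (r : nat) (a : nat -> nat).

Lemma decreasing_ge i :
  (forall i, (i < r)%N -> (a i.+1 < a i)%N) -> (i <= r)%N -> (r - i <= a i)%N.
Proof.
move=> a_decr /subnK; move: (r - i)%N => d; elim: d i => // d IH i dE.
have ir : (i < r)%N by lia.
by have := IH i.+1; have := a_decr _ ir; lia.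
Qed.

Lemma increasing_ge i :
  (forall i, (i < r)%N -> (a i < a i.+1)%N) -> (i <= r)%N -> (i <= a i)%N.
Proof.
by move=> a_incr; elim: i => // i IH ir; have := a_incr _ ir; have := IH (ltnW ir); lia.
Qed.

Lemma increasing_last i :
  (forall i, (i < r)%N -> (a i < a i.+1)%N) -> (i <= r)%N ->
  (a i + (r - i) <= a r)%N.
Proof.
move=> a_incr /subnK; move: (r - i)%N => d; elim: d i => [|d IH] i dE.
  by rewrite -dE addn0.
have ir : (i < r)%N by lia.
by have := IH i.+1; have := a_incr _ ir; lia.
Qed.

End Exponents.

Section AssociatedModule.
Variables (R : idomainType) (x y : R) (r : nat) (a b : nat -> nat).
Hypothesis r_ge2 : (2 <= r)%N.

Local Notation I := (monomial_ideal x y r a b).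
Local Notation M := (module_of x y r a b 2).
Local Notation K := {fraction R}.

Lemma module_genf i : (i < r)%N -> M (vec (x ^+ (a i).-1 * y ^+ b i) 0).
Proof.
move=> ir; apply: lspan_gen => //; left; left; exists i; first by rewrite /=; lia.
rewrite addn1 subSS subn1; apply: colvec2P; rewrite !mxE /= ?mulr1 ?mulr0 //.
Qed.

Lemma module_geng : M (vec y x).
Proof.
apply: lspan_gen => //; left; right; exists 1%N => //.
by apply: colvec2P; rewrite !mxE /=; ring.
Qed.

Lemma module_genh : M (vec 0 (y ^+ (b r).-1)).
Proof.
apply: lspan_gen => //; right; exists 1%N => //.
have -> : (r - 2 + 1 + 1 = r)%N by lia.
by rewrite subn1; apply: colvec2P; rewrite !mxE /= ?mulr1 ?mulr0.
Qed.

Lemma module_sub : submodule M.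
Proof. exact: lspan_submodule. Qed.

Lemma module_min (N : set 'cV[R]_2) :
  submodule N ->
  (forall i, (i < r)%N -> N (vec (x ^+ (a i).-1 * y ^+ b i) 0)) ->
  N (vec y x) -> N (vec 0 (y ^+ (b r).-1)) -> M `<=` N.
Proof.
move=> sN Nf Ng Nh; apply: lspan_min => // _ [[[i /= ile <-]|[i /= i1 <-]]|[i /= i1 <-]].
- have ir : (i < r)%N by lia.
  suff <- : vec (x ^+ (a i).-1 * y ^+ b i) 0 =
    (x ^+ (a i + 1 - 2) * y ^+ b i) *: eps R 2 1 by exact: Nf.
  rewrite addn1 subSS subn1.
  by apply: colvec2P; rewrite !mxE /= ?mulr1 ?mulr0.
- have -> : i = 1%N by lia.
  suff <- : vec y x = y *: eps R 2 1 + x *: eps R 2 2 by [].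
  by apply: colvec2P; rewrite !mxE /=; ring.
- have -> : i = 1%N by lia.
  have -> : (r - 2 + 1 + 1 = r)%N by lia.
  suff <- : vec 0 (y ^+ (b r).-1) = y ^+ (b r - 1) *: eps R 2 2 by [].
  by rewrite subn1; apply: colvec2P; rewrite !mxE /= ?mulr1 ?mulr0.
Qed.

Hypothesis b_incr : forall i, (i < r)%N -> (b i < b i.+1)%N.

(** Eliminating the second coordinate between [g] and [h] yields the generator
    of [I : x] that does not come from the [f_i]. *)
Lemma module_last : M (vec (y ^+ b r) 0).
Proof.
have -> : vec (y ^+ b r) 0 =
    y ^+ (b r).-1 *: vec y x + (- x) *: vec 0 (y ^+ (b r).-1).
  have [n ->] : exists n, b r = n.+1.
    by exists (b r).-1; have := increasing_ge b_incr (leqnn r); lia.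
  by apply: colvec2P; rewrite !mxE /= ?exprS; ring.
have sM := module_sub.
by apply: submoduleD => //; apply: submoduleZ => //; [exact: module_geng|exact: module_genh].
Qed.

Hypothesis b_0 : b 0%N = 0%N.
Hypothesis a_decr : forall i, (i < r)%N -> (a i.+1 < a i)%N.

Lemma module_powers :
  exists N, forall w, M (x ^+ N *: w) /\ M (y ^+ N *: w).
Proof.
have sM := module_sub; exists (a 0 + b r)%N => w.
have a0 : (0 < a 0)%N by have := decreasing_ge a_decr (leq0n r); lia.
have b0 : (0 < b r)%N by have := increasing_ge b_incr (leqnn r); lia.
have Mx1 : M (vec (x ^+ (a 0).-1) 0).
  have := @module_genf 0; rewrite b_0 expr0 mulr1; apply; lia.
have Mx2 : M (vec 0 (x ^+ a 0)).
  have -> : vec 0 (x ^+ a 0) =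
      x ^+ (a 0).-1 *: vec y x + (- y) *: vec (x ^+ (a 0).-1) 0.
    have [n ->] : exists n, a 0%N = n.+1 by exists (a 0%N).-1; lia.
    by apply: colvec2P; rewrite !mxE /= ?exprS; ring.
  by apply: submoduleD => //; apply: submoduleZ => //; exact: module_geng.
have split_w (s : R) n1 n2 N : (n1 <= N)%N -> (n2 <= N)%N ->
    M (vec (s ^+ n1) 0) -> M (vec 0 (s ^+ n2)) -> M (s ^+ N *: w).
  move=> le1 le2 M1 M2.
  have -> : s ^+ N *: w = (s ^+ (N - n1) * w 0 0) *: vec (s ^+ n1) 0 +
      (s ^+ (N - n2) * w 1 0) *: vec 0 (s ^+ n2).
    apply: colvec2P; rewrite !mxE /= mulr0 ?addr0 ?add0r mulrAC -exprD subnK //.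
  by apply: submoduleD => //; apply: submoduleZ.
split.
  by apply: split_w Mx1 Mx2; lia.
by apply: split_w module_last module_genh; lia.
Qed.

Lemma module_rank : parameters x y -> has_rank M 2.
Proof.
move=> xyP; exists fullv; last by rewrite dimvf dim_matrix.
apply/seteqP; split=> [f _|f _]; first by rewrite /= memvf.
have [N MN] := module_powers.
have xN0 : (x ^+ N)%:F != 0 by rewrite tofrac_eq0 expf_neq0 // (param_neq0l xyP).
exists 2%N, (fun i => f i 0 / (x ^+ N)%:F),
  (fun i => map_mx (@tofrac R) (x ^+ N *: delta_mx i 0)); split=> //.
  by move=> i; exists (x ^+ N *: delta_mx i 0) => //; have [] := MN (delta_mx i 0).
apply/colP => k; rewrite summxE (bigD1 k) //= big1 => [|i ik].
  by rewrite !mxE eqxx mulr1 addr0 divfK.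
by rewrite !mxE eq_sym (negbTE ik) mulr0 tofrac0 mulr0.
Qed.

Hypothesis a_r : a r = 0%N.

Lemma ideal_monomial i j k :
  (k <= r)%N -> (a k <= i)%N -> (b k <= j)%N -> I (x ^+ i * y ^+ j).
Proof.
move=> kr ai bj; rewrite monomial_idealE.
by apply: (@monomial_span_in _ x y _ (i, j)); exists k.
Qed.

Lemma monomial_ideal_ideal : ideal I.
Proof. exact: ideal_gen_ideal. Qed.

Lemma wedge_in_ideal u v : M u -> M v -> I (wedge u v).
Proof.
have iI := monomial_ideal_ideal.
have subl (w : 'cV[R]_2) : submodule [set u | I (wedge u w)].
  apply/submoduleP; split; first by rewrite /= /wedge !mxE !mul0r subr0; exact: ideal0.
  by move=> c u1 u2 /= I1 I2; rewrite wedgePl; apply: idealD => //; exact: idealMl.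
have subr (w : 'cV[R]_2) : submodule [set u | I (wedge w u)].
  apply/submoduleP; split; first by rewrite /= /wedge !mxE !mulr0 subr0; exact: ideal0.
  by move=> c u1 u2 /= I1 I2; rewrite wedgePr; apply: idealD => //; exact: idealMl.
have Ifg i : (i < r)%N ->
    I (wedge (vec (x ^+ (a i).-1 * y ^+ b i) 0) (vec y x)).
  move=> ir; rewrite /wedge !mxE /= mul0r subr0 mulrAC -exprSr.
  apply: (ideal_monomial (k := i)) => //; first exact: ltnW.
  by have := decreasing_ge a_decr (ltnW ir); lia.
(* The minor [f_0 /\ h] is a multiple of the generator of index 1, the others of
   the last generator. *)
have Ifh i : (i < r)%N ->
    I (wedge (vec (x ^+ (a i).-1 * y ^+ b i) 0) (vec 0 (y ^+ (b r).-1))).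
  move=> ir; rewrite /wedge !mxE /= mul0r subr0 -mulrA -exprD.
  case: i ir => [|i] ir.
    apply: (ideal_monomial (k := 1)); rewrite ?(ltnW r_ge2) //.
      by have := a_decr ir; lia.
    by have := increasing_last b_incr (ltnW r_ge2); rewrite b_0; lia.
  apply: (ideal_monomial (k := r)); rewrite ?a_r //.
  by have := increasing_ge b_incr (ltnW ir); have := increasing_last b_incr (ltnW ir); lia.
have Igh : I (wedge (vec y x) (vec 0 (y ^+ (b r).-1))).
  rewrite /wedge !mxE /= mulr0 subr0 -exprS -[_ ^+ _]mul1r -[1](expr0 x).
  apply: (ideal_monomial (k := r)); rewrite ?a_r //.
  by have := increasing_ge b_incr (leqnn r); lia.
have Iself (w : 'cV[R]_2) : I (wedge w w).
  by rewrite /wedge mulrC subrr; exact: ideal0.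
have IC (w1 w2 : 'cV[R]_2) : I (wedge w1 w2) -> I (wedge w2 w1).
  by move=> Iw; rewrite wedgeC; exact: idealN.
move=> Mu Mv; move: Mu; apply: (module_min (subl v)).
- move=> i ir; move: Mv; apply: (module_min (subr _)) => [j jr| |]; last exact: Ifh.
    by rewrite /= /wedge !mxE /= mulr0 mul0r subrr; exact: ideal0.
  exact: Ifg.
- move: Mv; apply: (module_min (subr _)) => [j jr| |]; last exact: Igh.
    by apply: IC; exact: Ifg.
  exact: Iself.
- move: Mv; apply: (module_min (subr _)) => [j jr| |]; last exact: Iself.
    by apply: IC; exact: Ifh.
  exact: IC.
Qed.

End AssociatedModule.

(** * Integral closure of the module *)

Section ClosedModule.
Variables (R : idomainType) (x y : R) (r : nat) (a b : nat -> nat).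
Hypotheses (r_ge2 : (2 <= r)%N)
  (a_decr : forall i, (i < r)%N -> (a i.+1 < a i)%N) (a_r : a r = 0%N)
  (b_0 : b 0%N = 0%N) (b_incr : forall i, (i < r)%N -> (b i < b i.+1)%N).

Local Notation I := (monomial_ideal x y r a b).
Local Notation M := (module_of x y r a b 2).
Local Notation K := {fraction R}.

Hypothesis xyP : parameters x y.

(** Divided by [x], the generators of [I] other than the last one are the
    coefficients of the [f_i]. The last one is [y^(b r)], and its coefficient in
    an element divisible by [x] is itself divisible by [x]. *)
Lemma module_colon u : I (x * u) -> M (vec u 0).
Proof.
have sM := module_sub x y r a b.
have veclin (c p q : R) : vec (c * p + q) 0 = c *: vec p 0 + vec q 0.
  by apply: colvec2P; rewrite !mxE /= ?mulr0 ?addr0.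
pose J : set R := [set z | exists A B, z = x * A + y ^+ b r * B /\ M (vec A 0)].
have IJ : I `<=` J.
  apply: ideal_gen_min => [|_ [k /= kr <-]].
    apply/idealP; split.
      exists 0, 0; rewrite !mulr0 addr0; split=> //.
      suff -> : vec 0 0 = 0 :> 'cV[R]_2 by exact: submodule0.
      by apply: colvec2P; rewrite !mxE.
    move=> c _ _ [A [B [-> MA]]] [A' [B' [-> MA']]].
    exists (c * A + A'), (c * B + B'); split; first by ring.
    by rewrite veclin; apply: submoduleD => //; exact: submoduleZ.
  move: kr; rewrite leq_eqVlt => /orP[/eqP ->|kr].
    exists 0, 1; rewrite a_r expr0 mulr0 add0r mulr1 mul1r; split=> //.
    suff -> : vec 0 0 = 0 :> 'cV[R]_2 by exact: submodule0.
    by apply: colvec2P; rewrite !mxE.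
  exists (x ^+ (a k).-1 * y ^+ b k), 0; split; last exact: module_genf.
  rewrite mulr0 addr0 mulrA -exprS prednK //.
  by have := decreasing_ge a_decr (ltnW kr); lia.
move=> /IJ[A [B [xuE MA]]].
have [D BE] : divides (x ^+ 1) B.
  apply: (xpow_dvd_cancel xyP (j := b r)); exists (u - A).
  by rewrite mulrBr xuE addrC addKr.
have -> : u = D * y ^+ b r + A.
  apply: (mulfI (param_neq0l xyP)); rewrite xuE BE; ring.
rewrite veclin; apply: submoduleD => //; apply: submoduleZ => //.
exact: module_last.
Qed.

(** The extension of [M] to a valuation ring has determinant ideal [I V], and
    its second coordinates lie in [(x, y^c) V]. So if [(u, v)] lies in all these
    extensions, then [v] is in [(x, y^c)] and [u x - v y] is in [I]; subtracting
    an element of [M] with second coordinate [v], one may take [v = 0], and then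
    [u] is in [I : x]. *)
Lemma module_integrally_closed :
  complete_ideal I ->
  (forall w : K,
    (forall V : set K, dvr_of V -> range (@tofrac R) `<=` V -> V w) ->
    range (@tofrac R) w) ->
  integrally_closed_module M.
Proof.
move=> Icomplete Rint; have sM := module_sub x y r a b.
apply/seteqP; split=> [f [_ fV]|_ [w Mw <-]]; last first.
  have Mf : frac_image M (map_mx (@tofrac R) w) by exists w.
  split; first exact: lspan_gen.
  move=> V _ RV; apply: lspan_gen => //.
  by rewrite -tofrac1; apply: RV; exists 1.
have intf i : range (@tofrac R) (f i 0).
  apply: Rint => V Vdvr RV.
  have lin (c : K) (u1 u2 : 'cV[K]_2) : (c *: u1 + u2) i 0 = c * u1 i 0 + u2 i 0.
    by rewrite !mxE.
  have := lspan_image (l := fun f : 'cV[K]_2 => f i 0) lin (fV V Vdvr RV).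
  case: Vdvr RV => v vP -> RV; apply: (lspan_valuation vP (k := 0)).
  by move=> _ [_ [w _ <-] <-]; apply: RV; exists (w i 0); rewrite // mxE.
have [[u _ uE] [v _ vE]] := (intf 0, intf 1).
have fE : f = map_mx (@tofrac R) (vec u v).
  by apply: colvec2P; rewrite !mxE.
pose Q := [set e : nat * nat | (0 < e.1)%N || ((b r).-1 <= e.2)%N].
have Qideal : ideal (monomial_span x y Q) := monomial_span_ideal x y Q.
have Mcoord : M `<=` [set w | monomial_span x y Q (w 1 0)].
  apply: (module_min r_ge2) => [|i ir||].
  - apply/submoduleP; split; first by rewrite /= mxE; exact: ideal0.
    by move=> c w1 w2 Q1 Q2; rewrite /= !mxE; apply: idealD => //; exact: idealMl.
  - by rewrite /= mxE; exact: ideal0.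
  - have := @monomial_span_in _ x y Q (1, 0)%N isT.
    by rewrite /monomial mulr1 /= mxE.
  - have := @monomial_span_in _ x y Q (0, (b r).-1)%N (leqnn _).
    by rewrite /monomial mul1r /= mxE.
have Qv : monomial_span x y Q v.
  apply: (valuatively_in_monomial_span xyP (N := (b r).+1)).
  - by move=> e e' /=; rewrite /Q /=; lia.
  - by move=> e; rewrite /Q /=; lia.
  - (* The weight is [c] for [x] and [1] for [y]. *)
    move=> e; rewrite /Q /= => /negP eQ; exists (b r).-1, 1%N.
    split=> //; rewrite ?coprimen1 //; first by lia.
    by move=> e'; rewrite /weight; nia.
  - move=> V Vdvr RV; rewrite vE.
    have := lspan_image (l := fun f : 'cV[K]_2 => f 1 0) _ (fV V Vdvr RV).
    have sub : (fun f : 'cV[K]_2 => f 1 0) @` frac_image M `<=`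
        (@tofrac R) @` monomial_span x y Q.
      by move=> _ [_ [w /Mcoord Qw <-] <-]; exists (w 1 0); rewrite // mxE.
    case=> [c w1 w2|n [c [w [Vc Mw ->]]]]; first by rewrite !mxE.
    by exists n, c, w; split=> // i; apply: sub.
have Iw : I (wedge (vec u v) (vec y x)).
  apply: (valuatively_in_complete xyP Icomplete a_r b_0) => V Vdvr RV.
  pose l (f : 'cV[K]_2) := f 0 0 * x%:F - f 1 0 * y%:F.
  have := lspan_image (l := l) _ (fV V Vdvr RV).
  have lE w : l (map_mx (@tofrac R) w) = (wedge w (vec y x))%:F.
    by rewrite /l /wedge tofracB !tofracM !mxE.
  have sub : l @` frac_image M `<=` (@tofrac R) @` I.
    move=> _ [_ [w Mw <-] <-]; exists (wedge w (vec y x)); last by rewrite lE.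
    by apply: wedge_in_ideal => //; exact: module_geng.
  rewrite -lE -fE; case=> [c w1 w2|n [c [w [Vc Mw ->]]]].
    by rewrite /l !mxE; ring.
  by exists n, c, w; split=> // i; apply: sub.
have [al [be vE']] : exists al be, v = x * al + y ^+ (b r).-1 * be.
  apply/ideal_gen2; apply: monomial_span_sub Qv; first exact: ideal_gen_ideal.
  move=> [i j]; rewrite /Q /monomial /= => /orP[i0|jb]; apply/ideal_gen2.
    by exists (x ^+ i.-1 * y ^+ j), 0; rewrite mulr0 addr0 mulrA -exprS prednK.
  exists 0, (x ^+ i * y ^+ (j - (b r).-1)).
  by rewrite mulr0 add0r mulrCA -exprD subnKC.
have bE : y ^+ b r = y * y ^+ (b r).-1.
  by rewrite -exprS prednK //; have := increasing_ge b_incr (leqnn r); lia.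
exists (vec u v); last by [].
have -> : vec u v = vec (u - al * y) 0 +
    (al *: vec y x + be *: vec 0 (y ^+ (b r).-1)).
  by apply: colvec2P; rewrite !mxE /= ?vE'; ring.
apply: submoduleD => //; last first.
  by apply: submoduleD => //; apply: submoduleZ => //; [exact: module_geng|exact: module_genh].
apply: module_colon.
have -> : x * (u - al * y) = wedge (vec u v) (vec y x) + be * y ^+ b r.
  by rewrite /wedge !mxE /= vE' bE; ring.
have iI := monomial_ideal_ideal x y r a b.
apply: idealD => //; apply: idealMl => //.
by rewrite -[y ^+ _]mul1r -[1](expr0 x); 
apply: (@ideal_monomial _ x y r a b 0 (b r) r); rewrite ?a_r.
Qed.

End ClosedModule.

(** * Biduals and the Fitting ideal *)

Section DualModule.
Variables (R : comNzRingType) (W : lmodType R) (M : set W).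
Hypothesis sM : submodule M.

Lemma dual0 (phi : W -> R^o) : dual M phi -> phi 0 = 0.
Proof.
move=> [phiL _]; have M0 := submodule0 sM.
have := phiL (-1) 0 0 M0 M0; rewrite scaler0 addr0 => phi0.
by rewrite phi0 scaleN1r addNr.
Qed.

Lemma dualZ (phi : W -> R^o) c w : dual M phi -> M w -> phi (c *: w) = c * phi w.
Proof.
move=> Dphi Mw; have [phiL _] := Dphi; have M0 := submodule0 sM.
by rewrite -[c *: w]addr0 phiL // (dual0 Dphi) addr0.
Qed.

Lemma dual_submodule : submodule (dual M).
Proof.
apply/submoduleP; split.
  by split=> // c u v _ _; rewrite scaler0 addr0.
move=> c phi psi [phiL phi0] [psiL psi0]; split=> [d u v Mu Mv|w nMw].
  rewrite !fctE phiL // psiL // !scalerDr !scalerA [c * d]mulrC.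
  by rewrite -!scalerA addrACA.
by rewrite !fctE phi0 // psi0 // scaler0 addr0.
Qed.

End DualModule.

Lemma patch_in (T U : Type) (d f : T -> U) (A : set T) t : A t -> patch d A f t = f t.
Proof. by move=> At; rewrite /patch mem_set. Qed.

Lemma patch_out (T U : Type) (d f : T -> U) (A : set T) t : ~ A t -> patch d A f t = d t.
Proof. by move=> At; rewrite /patch memNset. Qed.

Section FittingIdeal.
Variables (R : idomainType) (x y : R).
Hypothesis xyP : parameters x y.
Variables (M : set 'cV[R]_2) (J : set R) (N : nat).
Hypotheses (sM : submodule M)
  (MN : forall w : 'cV[R]_2, M (x ^+ N *: w) /\ M (y ^+ N *: w)).

Local Notation W := ('cV[R]_2).

Let xN0 : x ^+ N != 0.
Proof. by rewrite expf_neq0 // (param_neq0l xyP). Qed.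

(** A linear form on [M] extends to the plane: its values at [x^N w] and at
    [y^N w] satisfy [y^N phi (x^N w) = x^N phi (y^N w)], so that the former is
    divisible by [x^N]. *)
Lemma dual_coords (phi : W -> R^o) :
  dual M phi -> exists s t, forall w, M w -> phi w = s * w 0 0 + t * w 1 0.
Proof.
move=> Dphi; have [phiL _] := Dphi.
have div w : divides (x ^+ N) (phi (x ^+ N *: w)).
  apply: (xpow_dvd_cancel xyP (j := N)); exists (phi (y ^+ N *: w)).
  have [Mx My] := MN w.
  by rewrite -(dualZ sM _ Dphi Mx) -(dualZ sM _ Dphi My) !scalerA mulrC.
have [[s sE] [t tE]] := (div (vec 1 0), div (vec 0 1)).
exists s, t => w Mw; apply: (mulfI xN0).
have [Mx _] := MN (vec 1 0); have [My _] := MN (vec 0 1).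
rewrite -(dualZ sM _ Dphi Mw).
have -> : x ^+ N *: w = w 0 0 *: (x ^+ N *: vec 1 0) + w 1 0 *: (x ^+ N *: vec 0 1).
  by apply: colvec2P; rewrite !mxE /=; ring.
rewrite phiL //; last exact: submoduleZ.
by rewrite (dualZ sM _ Dphi My) sE tE /GRing.scale /=; ring.
Qed.

Lemma dual_coords_inj s t s' t' :
  (forall w : W, M w -> s * w 0 0 + t * w 1 0 = s' * w 0 0 + t' * w 1 0) ->
  s = s' /\ t = t'.
Proof.
move=> eqM; have [[Mx _] [My _]] := (MN (vec 1 0), MN (vec 0 1)).
split; apply: (mulIf xN0).
  by have := eqM _ Mx; rewrite !mxE /= !(mulr0, mulr1, addr0).
by have := eqM _ My; rewrite !mxE /= !(mulr0, mulr1, add0r).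
Qed.

(** The bidual is free on the two coordinates of linear forms, and the canonical
    map sends [w] in [M] to the combination with coefficients [w]. So the
    relations modulo [M] between the basis vectors are the elements of [M]. *)
Lemma fitting_ideal_of_plane_module :
  J = ideal_gen [set \det A | A in [set A : 'M[R]_2 | forall j, M (col j A)]] ->
  is_ideal_of_module M J.
Proof.
move=> JE.
have [co coP] : exists co : (W -> R^o) -> 'cV[R]_2, forall phi, dual M phi ->
    forall w, M w -> phi w = \sum_i co phi i 0 * w i 0.
  have [phi|co coP] := choice (P := fun (phi : W -> R^o) (c : 'cV[R]_2) =>
      dual M phi -> forall w, M w -> phi w = \sum_i c i 0 * w i 0).
    have [/dual_coords[s [t stP]]|] := pselect (dual M phi); last by exists 0.
    by exists (vec s t) => _ w /stP ->; rewrite sum_ord2 vec0E vec1E.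
  by exists co.
have coU phi (c : 'cV[R]_2) : dual M phi ->
    (forall w, M w -> phi w = \sum_i c i 0 * w i 0) -> co phi = c.
  move=> Dphi cP; have [|c0 c1] := @dual_coords_inj (co phi 0 0) (co phi 1 0) (c 0 0) (c 1 0).
    move=> w Mw; move: (cP w Mw); rewrite (coP phi Dphi w Mw).
    by rewrite !sum_ord2.
  exact: colvec2P.
have dualM c (phi psi : W -> R^o) : dual M phi -> dual M psi ->
    co (c *: phi + psi) = c *: co phi + co psi.
  move=> Dphi Dpsi; apply: coU => [|w Mw].
    by have /submoduleP[_ DL] := dual_submodule M; exact: DL.
  rewrite !fctE (coP phi Dphi w Mw) (coP psi Dpsi w Mw) !sum_ord2 !mxE.
  by rewrite /GRing.scale /=; ring.
pose chi i : W -> R^o := patch (fun=> 0) M (fun w => w i 0).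
have chiM i w : M w -> chi i w = w i 0 by move=> Mw; rewrite /chi patch_in.
have chiD i : dual M (chi i).
  split=> [c u v Mu Mv|w Mw]; last by rewrite /chi patch_out.
  rewrite !chiM ?mxE //; apply: submoduleD => //; exact: submoduleZ.
have co_chi i j : co (chi i) j 0 = (j == i)%:R.
  have -> : co (chi i) = delta_mx i 0.
    apply: coU => // w /chiM ->; rewrite (bigD1 i) //= big1 => [|k ki].
      by rewrite mxE !eqxx mul1r addr0.
    by rewrite mxE (negbTE ki) mul0r.
  by rewrite mxE eqxx andbT.
pose e i : (W -> R^o) -> R^o := patch (fun=> 0) (dual M) (fun phi => co phi i 0).
have eE i phi : dual M phi -> e i phi = co phi i 0.
  by move=> Dphi; rewrite /e patch_in.
have sD := dual_submodule M; have /submoduleP[_ DL] := sD.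
have eB i : bidual M (e i).
  split=> [c phi psi Dphi Dpsi|phi nD]; last by rewrite /e patch_out.
  by rewrite !eE ?dualM ?mxE //; exact: DL.
have bidualE Phi : bidual M Phi -> Phi = \sum_i Phi (chi i) *: e i.
  move=> BPhi; have [PhiL Phi0] := BPhi; apply/funext => phi; rewrite sum_ord2 !fctE.
  have [Dphi|nD] := pselect (dual M phi); last first.
    by rewrite Phi0 // /e !patch_out // !scaler0 addr0.
  have phiE : phi = co phi 0 0 *: chi 0 + co phi 1 0 *: chi 1.
    apply/funext => w; rewrite !fctE; have [Mw|nMw] := pselect (M w).
      by rewrite (coP phi Dphi w Mw) sum_ord2 !chiM.
    have [_ phi0] := Dphi.
    by rewrite phi0 // /chi !patch_out // !scaler0 addr0.
  rewrite {1}phiE PhiL //; last exact: submoduleZ.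
  by rewrite (dualZ sD _ BPhi (chiD 1)) !eE // /GRing.scale /=; ring.
have sB := dual_submodule (dual M).
have evE w : M w -> bidual_ev M w = \sum_i w i 0 *: e i.
  move=> Mw; apply/funext => phi; rewrite sum_ord2 !fctE /bidual_ev.
  have [Dphi|nD] := pselect (dual M phi); last first.
    by rewrite /e !patch_out // !scaler0 addr0.
  by rewrite patch_in // (coP phi Dphi w Mw) sum_ord2 !eE // /GRing.scale /=; ring.
exists 2%N, e; split.
  apply/seteqP; split=> [Phi /bidualE ->|].
    by exists 2%N, (fun i => Phi (chi i)), e; split=> // i; left; exists i.
  apply: lspan_min => // _ [[i _ <-] //|[w Mw <-]].
  by rewrite evE //; apply: submodule_sum => // i; exact: submoduleZ.
rewrite JE; congr ideal_gen; apply/seteqP.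
suff H (A : 'M[R]_2) : (forall j, M (col j A)) <->
    (forall j, (bidual_ev M @` M) (\sum_i A i j *: e i)).
  by split=> _ [A /H HA <-]; exists A.
have comb (c : 'I_2 -> R) j : (\sum_i c i *: e i) (chi j) = c j.
  rewrite fct_sumE (bigD1 j) //= big1 => [|i ij].
    by rewrite fctE eE // co_chi eqxx /GRing.scale /= mulr1 addr0.
  by rewrite fctE eE // co_chi (negbTE ij) scaler0.
split=> HA j.
  exists (col j A) => //; rewrite evE //.
  by apply: eq_bigr => i _; rewrite mxE.
have [w Mw wE] := HA j; suff -> : col j A = w by [].
apply/colP => i; rewrite mxE -(comb (fun i => A i j) i) -wE evE //.
by rewrite (comb (fun i => w i 0)).
Qed.

End FittingIdeal.

Lemma det_col2 (R : comNzRingType) (A : 'M[R]_2) :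
  \det A = wedge (col 0 A) (col 1 A).
Proof.
rewrite (expand_det_col _ 0) sum_ord2 /cofactor !det_mx11 /wedge !mxE /=.
have -> : lift 0 (0 : 'I_1) = 1 :> 'I_2 by exact: val_inj.
have -> : lift 1 (0 : 'I_1) = 0 :> 'I_2 by exact: val_inj.
by rewrite expr0 expr1; ring.
Qed.

(** The generators of [I] are the minors [f_k /\ g], for [k < r], and [g /\ h]. *)
Lemma module_minors_ideal (R : idomainType) (x y : R) (r : nat) (a b : nat -> nat) :
  (2 <= r)%N ->
  (forall i, (i < r)%N -> (b i < b i.+1)%N) -> b 0%N = 0%N ->
  (forall i, (i < r)%N -> (a i.+1 < a i)%N) -> a r = 0%N ->
  monomial_ideal x y r a b =
  ideal_gen [set \det A | A in
    [set A : 'M[R]_2 | forall j, module_of x y r a b 2 (col j A)]].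
Proof.
move=> r_ge2 b_incr b_0 a_decr a_r; set M := module_of x y r a b 2.
apply/seteqP; split; apply: ideal_gen_min; try exact: ideal_gen_ideal; last first.
  by move=> _ [A MA <-]; rewrite det_col2; 
  exact: (wedge_in_ideal r_ge2 b_incr b_0 a_decr a_r (MA 0) (MA 1)).
have det_in u v : M u -> M v -> ideal_gen [set \det A | A in
    [set A : 'M[R]_2 | forall j, M (col j A)]] (wedge u v).
  move=> Mu Mv; pose A := \matrix_(i < 2, j < 2) (if j == 0 then u else v) i 0.
  have colA j : col j A = if j == 0 then u else v by apply/colP => i; rewrite !mxE.
  apply: ideal_gen_in; exists A; last by rewrite det_col2 !colA.
  by move=> j; rewrite colA; case: ifP.
move=> _ [k /= + <-]; rewrite leq_eqVlt => /orP[/eqP ->|kr].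
  have [n nE] : exists n, b r = n.+1.
    by exists (b r).-1; have := increasing_ge b_incr (leqnn r); lia.
  have := det_in _ _ (module_geng x y r a b) (module_genh x y a b r_ge2).
  by rewrite /wedge !mxE /= mulr0 subr0 a_r nE mul1r exprS.
have [n nE] : exists n, a k = n.+1.
  by exists (a k).-1; have := decreasing_ge a_decr (ltnW kr); lia.
have := det_in _ _ (module_genf x y a b r_ge2 kr) (module_geng x y r a b).
by rewrite /wedge !mxE /= mul0r subr0 nE mulrAC -exprSr.
Qed.

(** * Indecomposability *)

Section Indecomposable.
Variables (R : idomainType) (m : set R) (x y : R).
Hypotheses (noethR : noetherian R) (locR : local_ring m) (dimR : krull_dim R 2)
  (mE : m = ideal_gen [set x; y]).

Let xyP : parameters x y := regular_parameters noethR locR dimR mE.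

Local Notation W := ('cV[R]_2).

Definition order_ge2 : set R :=
  monomial_span x y [set e | (2 <= e.1 + e.2)%N].

Lemma order_ge2_split s :
  order_ge2 s -> exists c d, [/\ m c, m d & s = x * c + y * d].
Proof.
have iM := max_ideal locR; have M0 := ideal0 iM.
move: s; apply: monomial_span_sub.
  apply/idealP; split; first by exists 0, 0; rewrite !mulr0 addr0.
  move=> a _ _ [c [d [mc md ->]]] [c' [d' [mc' md' ->]]].
  exists (a * c + c'), (a * d + d'); split; last by ring.
    by apply: idealD => //; exact: idealMl.
  by apply: idealD => //; exact: idealMl.
have mx := param_max1 mE; have my := param_max2 mE.
move=> [[|i] [|j]] //=; rewrite /monomial /= ?add0n ?addn0 => le2.
- exists 0, (y ^+ j); split; rewrite // ?mul1r ?mulr0 ?add0r -?exprS //.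
  by case: j le2 => // j _; rewrite exprS; exact: idealMr.
- exists (x ^+ i), 0; split; rewrite // ?mulr1 ?mulr0 ?addr0 -?exprS //.
  by case: i le2 => // i _; rewrite exprS; exact: idealMr.
- exists (x ^+ i * y ^+ j.+1), 0; split=> //; last by rewrite exprS; ring.
  by rewrite exprS mulrCA; exact: idealMr.
Qed.

(** Modulo [m^2] the entries of [w] are those of a linear combination of [(x, 0)]
    and [(y, x)]. *)
Definition initial_form (al be : R) (w : W) : Prop :=
  exists s t, [/\ order_ge2 s, order_ge2 t,
    w 0 0 = al * x + be * y + s & w 1 0 = be * x + t].

(** The coefficient matrix of [(p, q)] in terms of [(x, y)] has determinant
    congruent to [be^2] modulo [m]. *)
Lemma initial_form_parameters al be w :
  initial_form al be w -> be \is a GRing.unit ->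
  m = ideal_gen [set w 0 0; w 1 0].
Proof.
move=> [s [t [/order_ge2_split[s1 [s2 [ms1 ms2 ->]]]
  /order_ge2_split[t1 [t2 [mt1 mt2 ->]]] w0 w1]]] Ube.
have iM := max_ideal locR.
pose de := be * be + (be * (t1 + s2) + (s2 * t1 - (al + s1) * t2)).
have Ude : de \is a GRing.unit.
  apply: (unit_addmax noethR locR); first by rewrite unitrM Ube.
  apply: idealD => //; first by apply: idealMl => //; exact: idealD.
  by apply: idealB => //; exact: idealMl.
have xE : x = w 0 0 * (- t2 / de) + w 1 0 * ((be + s2) / de).
  apply: (mulIr Ude); rewrite mulrDl -!mulrA mulVr // !mulr1 w0 w1 /de; ring.
have yE : y = w 0 0 * ((be + t1) / de) + w 1 0 * (- (al + s1) / de).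
  apply: (mulIr Ude); rewrite mulrDl -!mulrA mulVr // !mulr1 w0 w1 /de; ring.
rewrite mE; apply/seteqP; split; apply: ideal_gen_min; try exact: ideal_gen_ideal.
  move=> _ [->|->]; apply/ideal_gen2.
    by exists (- t2 / de), ((be + s2) / de).
  by exists ((be + t1) / de), (- (al + s1) / de).
move=> _ [->|->]; apply/ideal_gen2.
  by exists (al + s1), (be + s2); rewrite w0; ring.
by exists (be + t1), t2; rewrite w1; ring.
Qed.

(** The entries [p, q] of [g1] form a regular system of parameters. Since [N1]
    lies on the line through [g1], the components in [N2] of [x^N w] and [y^N w]
    have determinants [x^N d] and [y^N d] with [g1], where [d] is the determinant
    of [g1] and [w]; as they are proportional, the first one is [x^N e] with [e]
    of determinant [d]. For [d = p] and [d = q] this gives proportional vectors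
    [e] and [e'], so that [q e = p e']. Then [p] divides [e], and the quotient has
    determinant [1] with [g1], whose entries are in the maximal ideal. *)
Lemma no_rank1_splitting (N1 N2 : set W) g1 al be N :
  submodule N2 -> N1 g1 ->
  (forall u v, N1 u -> N1 v -> wedge u v = 0) ->
  (forall u v, N2 u -> N2 v -> wedge u v = 0) ->
  (forall w, exists u v, [/\ N1 u, N2 v & x ^+ N *: w = u + v]) ->
  (forall w, exists u v, [/\ N1 u, N2 v & y ^+ N *: w = u + v]) ->
  initial_form al be g1 -> be \is a GRing.unit -> False.
Proof.
move=> sN2 Ng1 line1 line2 Mx My g1E Ube.
have pqP := regular_parameters noethR locR dimR (initial_form_parameters g1E Ube).
set p := g1 0 0 in pqP; set q := g1 1 0 in pqP.
have xN0 : x ^+ N != 0 by rewrite expf_neq0 // (param_neq0l xyP).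
have lift w : wedge g1 w != 0 ->
    exists2 e, N2 (x ^+ N *: e) & wedge g1 e = wedge g1 w.
  move=> gw0; have [u [n [Nu Nn xE]]] := Mx w; have [u' [n' [Nu' Nn' yE]]] := My w.
  have gn : wedge g1 n = x ^+ N * wedge g1 w.
    by rewrite -wedgeZr xE -[u]scale1r wedgePr (line1 _ _ Ng1 Nu) mulr0 add0r.
  have gn' : wedge g1 n' = y ^+ N * wedge g1 w.
    by rewrite -wedgeZr yE -[u']scale1r wedgePr (line1 _ _ Ng1 Nu') mulr0 add0r.
  have nn' : y ^+ N *: n = x ^+ N *: n'.
    have := wedge_cramer g1 n n'; rewrite gn gn' (line2 _ _ Nn' Nn) scale0r add0r.
    move=> E; have E' i : y ^+ N * n i 0 = x ^+ N * n' i 0.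
      apply: (mulfI gw0); have := congr1 (fun w : W => w i 0) E.
      rewrite !mxE => Ei; transitivity (y ^+ N * wedge g1 w * n i 0); first by ring.
      by rewrite -Ei; ring.
    by apply: colvec2P; rewrite !mxE.
  have ndiv i : divides (x ^+ N) (n i 0).
    apply: (xpow_dvd_cancel xyP (j := N)); exists (n' i 0).
    by have := congr1 (fun w : W => w i 0) nn'; rewrite !mxE.
  have [[c0 n0] [c1 n1]] := (ndiv 0, ndiv 1).
  have nE : n = x ^+ N *: vec c0 c1 by apply: colvec2P; rewrite !mxE.
  exists (vec c0 c1); first by rewrite -nE.
  by apply: (mulfI xN0); rewrite -gn nE wedgeZr.
have gp : wedge g1 (vec 0 1) = p by rewrite /wedge !mxE /= mulr1 mulr0 subr0.
have gq : wedge g1 (vec (-1) 0) = q by rewrite /wedge !mxE /= -/p -/q; ring.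
have [|e Ne ge] := lift (vec 0 1); first by rewrite gp (param_neq0l pqP).
have [|e' Ne' ge'] := lift (vec (-1) 0); first by rewrite gq (param_neq0r pqP).
have ee' : wedge e' e = 0.
  have := line2 _ _ Ne' Ne; rewrite wedgeZr wedgeC wedgeZr => /eqP.
  by rewrite mulf_eq0 (negbTE xN0) oppr_eq0 mulf_eq0 (negbTE xN0) wedgeC oppr_eq0 => /eqP.
have pe i : divides p (e i 0).
  apply: (param_syz pqP (a := e' i 0)).
  have := congr1 (fun w : W => w i 0) (wedge_cramer g1 e e').
  by rewrite ge ge' gp gq ee' scale0r add0r !mxE.
have [[c0 e0] [c1 e1]] := (pe 0, pe 1).
apply: (param_proper pqP (d := c1) (e := - c0)).
apply: (mulfI (param_neq0l pqP)); rewrite mulr1 -[RHS]gp -ge /wedge e0 e1.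
by rewrite -/p -/q; ring.
Qed.

Variables (r : nat) (a b : nat -> nat).
Hypotheses (r_ge2 : (2 <= r)%N)
  (a_decr : forall i, (i < r)%N -> (a i.+1 < a i)%N) (a_r : a r = 0%N)
  (b_0 : b 0%N = 0%N) (b_incr : forall i, (i < r)%N -> (b i < b i.+1)%N)
  (a0_le_br : (a 0%N <= b r)%N)
  (cond : (3 <= r)%N \/ (r = 2%N /\ ~ monomial_ideal x y r a b (x * y))).

Local Notation M := (module_of x y r a b 2).

(** Among the generators, a coefficient [x^(a i - 1) y^(b i)] of order less than
    [2] other than [x], or [y^c] of order less than [2], forces [r = 2] and
    [x y] in [I]; for [y^c] this uses [a 0 <= b r]. *)
Lemma module_initial_form w : M w -> exists al be, initial_form al be w.
Proof.
have mono2 i j : (2 <= i + j)%N -> order_ge2 (x ^+ i * y ^+ j).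
  by move=> le2; apply: (@monomial_span_in _ x y _ (i, j)).
have mono20 : order_ge2 0 by apply: ideal0; exact: monomial_span_ideal.
have noxy : r = 2%N -> a 1%N = 1%N -> b 1%N = 1%N -> False.
  move=> r2 a1 b1; case: cond => [|[_ xyI]]; first by lia.
  by apply: xyI; have := @ideal_monomial _ x y r a b 1 1 1; rewrite a1 b1 r2; apply.
move: w; apply: (module_min r_ge2 (N := [set w | exists al be, initial_form al be w])).
- apply/submoduleP; split.
    by exists 0, 0, 0, 0; split; rewrite // !mxE; ring.
  move=> c u v [al [be [s [t [s2 t2 u0 u1]]]]] [al' [be' [s' [t' [s2' t2' v0 v1]]]]].
  have i2 := monomial_span_ideal x y [set e | (2 <= e.1 + e.2)%N].
  exists (c * al + al'), (c * be + be'), (c * s + s'), (c * t + t').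
  split; rewrite ?mxE ?u0 ?u1 ?v0 ?v1; try ring.
    by apply: idealD => //; exact: idealMl.
  by apply: idealD => //; exact: idealMl.
- move=> i ir; have ai := decreasing_ge a_decr (ltnW ir).
  have bi := increasing_ge b_incr (ltnW ir).
  have [le2|lt2] := leqP 2 ((a i).-1 + b i).
    by exists 0, 0, (x ^+ (a i).-1 * y ^+ b i), 0; split;
      rewrite ?mxE //=; [exact: mono2|ring|ring].
  have i0 : i = 0%N.
    by case: i ir ai bi lt2 => // -[|i] ir ai bi lt2; [case: noxy; lia|lia].
  exists 1, 0, 0, 0; split; rewrite // !mxE /= ?i0 ?b_0; last by ring.
  by rewrite (_ : (a 0%N).-1 = 1%N); [ring|rewrite i0 in ai lt2; lia].
- by exists 0, 1, 0, 0; split; rewrite // !mxE /=; ring.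
- exists 0, 0, 0, (y ^+ (b r).-1); split; rewrite ?mxE //=; try ring.
  rewrite -[y ^+ _]mul1r -[1](expr0 x); apply: mono2; rewrite add0n.
  have br := increasing_ge b_incr (leqnn r).
  have a01 := a_decr (ltnW r_ge2); have a12 := a_decr r_ge2.
  have b01 := b_incr (ltnW r_ge2); have b12 := increasing_last b_incr (ltnW r_ge2).
  have [r3|r3] := leqP 3 r; first by lia.
  have r2 : r = 2%N by lia.
  rewrite leqNgt; apply/negP => lt2; apply: noxy => //; lia.
Qed.

(** By Cramer's rule a summand that contains two independent vectors meets every
    other one, so both summands lie on lines. The components of [g = (y, x)] have
    coefficients at [(y, x)] whose sum is congruent to [1] modulo [m], so one of
    these coefficients is a unit. *)
Lemma module_indecomposable : indecomposable M.
Proof.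
have sM := module_sub x y r a b.
have Mg := module_geng x y r a b.
have y0 := param_neq0r xyP.
split=> [M0|N1 N2 sN1 sN2 MN N12].
  have : vec y x = 0 by move: Mg; rewrite M0.
  by move=> /(congr1 (fun w : W => w 0 0)); rewrite !mxE => /eqP; rewrite (negbTE y0).
apply: contrapT => /not_orP[N1n0 N2n0].
have nonzero (N : set W) : submodule N -> N <> [set 0] ->
    exists w i, N w /\ w i 0 != 0.
  move=> sN Nn0; apply: contrapT => noN; apply: Nn0.
  apply/seteqP; split=> [w Nw|_ ->]; last exact: submodule0.
  apply/colP => i; rewrite mxE; apply: contrapT => /eqP wi0.
  by apply: noN; exists w, i.
have line (N N' : set W) : submodule N -> submodule N' -> N' <> [set 0] ->
    N `&` N' = [set 0] -> forall u v, N u -> N v -> wedge u v = 0.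
  move=> sN sN' N'0 NN' u v Nu Nv; have [w [i [Nw wi0]]] := nonzero N' sN' N'0.
  have : (N `&` N') (wedge u v *: w).
    split; last exact: submoduleZ.
    by rewrite wedge_cramer; apply: submoduleD => //; exact: submoduleZ.
  rewrite NN' => /(congr1 (fun w : W => w i 0)); rewrite !mxE => /eqP.
  by rewrite mulf_eq0 (negbTE wi0) orbF => /eqP.
have N21 : N2 `&` N1 = [set 0] by rewrite setIC.
have line1 := line _ _ sN1 sN2 N2n0 N12; have line2 := line _ _ sN2 sN1 N1n0 N21.
have [g1 Ng1 [g2 Ng2 gE]] : [set u + v | u in N1 & v in N2] (vec y x) by rewrite -MN.
have MN1 u : N1 u -> M u.
  by move=> Nu; rewrite MN; exists u => //; exists 0; rewrite ?addr0 //; exact: submodule0.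
have MN2 u : N2 u -> M u.
  by move=> Nu; rewrite MN; exists 0; [exact: submodule0|exists u; rewrite ?add0r].
have [al1 [be1 /[dup] g1E [s1 [t1 [_ t12 _ g11]]]]] := module_initial_form (MN1 _ Ng1).
have [al2 [be2 /[dup] g2E [s2 [t2 [_ t22 _ g21]]]]] := module_initial_form (MN2 _ Ng2).
have [N MNw] := module_powers x y r_ge2 b_incr b_0 a_decr.
have decomp (s : R) : (forall w, M (s *: w)) ->
    forall w, exists u v, [/\ N1 u, N2 v & s *: w = u + v].
  by move=> Ms w; have := Ms w; rewrite MN => -[u Nu [v Nv <-]]; exists u, v.
have decompC (s : R) : (forall w, M (s *: w)) ->
    forall w, exists u v, [/\ N2 u, N1 v & s *: w = u + v].
  by move=> Ms w; have [u [v [Nu Nv ->]]] := decomp s Ms w; exists v, u; rewrite addrC.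
have Mx w : M (x ^+ N *: w) by have [] := MNw w.
have My w : M (y ^+ N *: w) by have [] := MNw w.
have [U1|nU1] := boolP (be1 \is a GRing.unit).
  exact: (no_rank1_splitting sN2 Ng1 line1 line2 (decomp _ Mx) (decomp _ My) g1E U1).
have [U2|nU2] := boolP (be2 \is a GRing.unit).
  exact: (no_rank1_splitting sN1 Ng2 line2 line1 (decompC _ Mx) (decompC _ My) g2E U2).
have U12 : 1 + - (be1 + be2) \is a GRing.unit.
  have nm c : c \isn't a GRing.unit -> m c.
    by move=> nU; apply: contrapT => /(nonunit_max noethR locR); exact/negP.
  have iM := max_ideal locR; apply: (unit_addmax noethR locR) (unitr1 _) _.
  by apply: idealN => //; apply: idealD => //; exact: nm.
have : order_ge2 ((1 + - (be1 + be2)) * monomial x y (1, 0)%N).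
  have -> : (1 + - (be1 + be2)) * monomial x y (1, 0)%N = t1 + t2.
    have := congr1 (fun w : W => w 1 0) gE; rewrite !mxE /= g11 g21 => xE.
    by rewrite /monomial mulr1 expr1 mulrDl mul1r -{1}xE; ring.
  exact: monomial_spanD.
move=> /(monomial_spanM (1 + - (be1 + be2))^-1); rewrite mulKr //.
by move=> /(monomial_in_span xyP)[[i j] [/= le2 lei lej]]; lia.
Qed.

End Indecomposable.

(** * The main result *)

Theorem corollary6p2 (R : idomainType) (m : set R) (x y : R)
    (r : nat) (a b : nat -> nat)
    (regR : regular_local_ring m 2)
    (infinite_residue_field : infinite_set (cosets m))
    (xy_params : m = ideal_gen [set x; y])
    (r_ge2 : (2 <= r)%N)
    (a_decr : forall i, (i < r)%N -> (a i.+1 < a i)%N)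
    (a_r : a r = 0%N)
    (b_0 : b 0%N = 0%N)
    (b_incr : forall i, (i < r)%N -> (b i < b i.+1)%N)
    (a0_le_br : (a 0%N <= b r)%N)
    (I_complete : complete_ideal (monomial_ideal x y r a b))
    (cond : (3 <= r)%N \/ (r = 2%N /\ ~ monomial_ideal x y r a b (x * y))) :
  let I := monomial_ideal x y r a b in
  let M := module_of x y r a b 2 in
  [/\ indecomposable M,
      integrally_closed_module M,
      has_rank M 2
    & is_ideal_of_module M I].
Proof.
have [noethR locR dimR _] := regR.
have xyP := regular_parameters noethR locR dimR xy_params.
split.
- exact: (module_indecomposable noethR locR dimR xy_params).
- apply: module_integrally_closed => // w.
  exact: (valuatively_integral noethR locR dimR xy_params).
- exact: module_rank.
- have [N MN] := module_powers x y r_ge2 b_incr b_0 a_decr.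
  apply: (fitting_ideal_of_plane_module xyP (module_sub x y r a b) MN).
  exact: module_minors_ideal.
Qed.
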